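(* There is a faithful (forgetful) functor from the category $\mathcal{N}$ of MLL proof nets to $\mathbf{GoI}(\mathsf{Setp})$, sending an MLL formula $A$ to the signed set of its leaves, and sending a proof net $f:A\to B$ to its underlying leaf function, viewed as a partial function from (positive leaves of $A$) $+$ (negative leaves of $B$) to (negative leaves of $A$) $+$ (positive leaves of $B$).
   Context: Formulas (MLL) are built from literals (propositional variables $P,Q,\dots$ and their duals $P^\bot,Q^\bot,\dots$) and units $1,\bot$ by the binary connectives $\otimes$ (tensor) and $\wp$ (par, the multiplicative disjunction of linear logic). An atom is a literal or a unit. Negation $(-)^\bot$ extends to all formulas by $P^{\bot\bot}=P$, $\bot^\bot=1$, $1^\bot=\bot$, $(A\otimes B)^\bot=A^\bot\wp B^\bot$, $(A\wp B)^\bot=A^\bot\otimes B^\bot$. A formula is identified with its parse tree (leaves labelled by atoms, internal vertices by connectives). A leaf (or atom) is positive if labelled by a propositional variable or $1$, and negative if labelled by a dual $P^\bot$ or by $\bot$. The $i$-th leaf of $A^\bot$ corresponds to the $i$-th leaf of $A$, with opposite sign. A sequent is a non-empty disjoint union of formulas (a labelled forest). A cut pair on $A$ is the disjoint union of $A$ and $A^\bot$ together with an undirected edge (a cut) between their roots. A cut sequent is a disjoint union of a sequent and zero or more cut pairs. A switching of a cut sequent is any subgraph obtained by deleting, for each $\wp$ vertex, one of its two argument edges. A leaf function on a cut sequent is a function from its negative leaves to its positive leaves. A proof net on a cut sequent $\Gamma$ is a leaf function $f$ on $\Gamma$ such that: (Matching) for every propositional variable $P$, $f$ restricts to a bijection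 between the $P^\bot$-labelled leaves and the $P$-labelled leaves of $\Gamma$; (Switching) for every switching $\Gamma'$ of $\Gamma$, the undirected graph obtained by adding the edges $\{l,f(l)\}$ of $f$ to $\Gamma'$ is a tree (acyclic and connected; parallel edges count as a cycle). Eliminating a cut. Let $f$ be a proof net on the cut sequent consisting of $\Gamma$ and a cut pair on $A$. - Atom: if $A$ is an atom, say (without loss of generality) positive, delete the cut pair $A,A^\bot$, and reset every edge of $f$ targeting the leaf $A$ to target $f(A^\bot)$ instead. - Compound: if $A$ is compound, say (without loss of generality) $A=B\otimes C$ and $A^\bot=B^\bot\wp C^\bot$, replace the cut pair on $A$ by two cut pairs, one on $B$ (joining the roots of $B$ and $B^\bot$) and one on $C$ (joining the roots of $C$ and $C^\bot$); the leaves and the function $f$ are unchanged. Cut elimination preserves proof nets, is locally confluent and strongly normalising; the normal form is the (unique) result of eliminating all cuts. The category $\mathcal{N}$ of MLL proof nets: objects are MLL formulas; a morphism $A\to B$ is a proof net on the (cut-free) sequent $A^\bot,B$; the composite of $f:A\to B$ and $g:B\to C$ is the normal form of the proof net $f\cup g$ on the cut sequent consisting of $A^\bot$, $C$ and the cut pair joining the $B$ of $f$ to the $B^\bot$ of $g$; the identity $A\to A$ has, for each $i$, an edge between the $i$-th leaf of $A^\bot$ and the $i$-th leaf of $A$, oriented from negative to positive. The category $\mathbf{GoI}(\mathsf{Setp})$ (geometry-of-interaction construction on sets and partial functions): an object is a signed set $S$ (each element, called a leaf, is positive or negative); write $S^+$, $S^-$ for the sets of positive and negative leaves. A morphism $S\to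 T$ is a partial function from $S^+ + T^-$ to $S^- + T^+$. Composition of $f:S\to T$ and $g:T\to U$ is finite path composition: starting at $x\in S^+$ (apply $f$) or $x\in U^-$ (apply $g$), whenever the current value lies in $T^+$ apply $g$, whenever it lies in $T^-$ apply $f$, and stop when it lies in $S^-+U^+$, that value being the result; the composite is undefined at $x$ if some step is undefined or the process never stops. The identity on $S$ relates each leaf to its copy. *)

(* Defs.v *)
From mathcomp Require Import all_boot.
From mathcomp Require Import boolp classical_sets functions.
From Stdlib Require Import Relation_Operators.

Set Implicit Arguments.
Unset Strict Implicit.
Unset Printing Implicit Defensive.

(* Composition is in diagrammatic order: [comp f g] is f followed by g. *)
Record category (Ob : Type) (Hom : Ob -> Ob -> Type) := Category {
  idm : forall A, Hom A A;
  comp : forall A B C, Hom A B -> Hom B C -> Hom A C;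
  comp_idl : forall A B (f : Hom A B), comp (idm A) f = f;
  comp_idr : forall A B (f : Hom A B), comp f (idm B) = f;
  compA : forall A B C D (f : Hom A B) (g : Hom B C) (h : Hom C D),
    comp f (comp g h) = comp (comp f g) h }.

Definition is_functor (Ob Ob' : Type) (Hom : Ob -> Ob -> Type)
    (Hom' : Ob' -> Ob' -> Type) (C : category Hom) (D : category Hom')
    (F : Ob -> Ob') (Fm : forall A B, Hom A B -> Hom' (F A) (F B)) : Prop :=
  (forall A, Fm A A (idm C A) = idm D (F A)) /\
  (forall X Y Z (f : Hom X Y) (g : Hom Y Z),
     Fm X Z (comp C f g) = comp D (Fm X Y f) (Fm Y Z g)).

Definition is_faithful (Ob Ob' : Type) (Hom : Ob -> Ob -> Type)
    (Hom' : Ob' -> Ob' -> Type) (C : category Hom) (D : category Hom')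
    (F : Ob -> Ob') (Fm : forall A B, Hom A B -> Hom' (F A) (F B)) : Prop :=
  forall A B, injective (Fm A B).

Arguments is_functor {Ob Ob' Hom Hom'} C D F Fm.
Arguments is_faithful {Ob Ob' Hom Hom'} C D F Fm.

Record signed := Signed { carrier :> Type; positive : carrier -> bool }.

Definition pos (S : signed) := {x : S | positive x}.
Definition neg (S : signed) := {x : S | ~~ positive x}.

Definition sign_preserving (S T : signed) (h : S -> T) :=
  forall x, positive (h x) = positive x.

Definition pos_map (S T : signed) (h : S -> T) (hP : sign_preserving h)
    (x : pos S) : pos T :=
  exist _ (h (sval x)) (etrans (hP (sval x)) (svalP x)).

Definition neg_map (S T : signed) (h : S -> T) (hP : sign_preserving h)
    (x : neg S) : neg T :=
  exist _ (h (sval x)) (etrans (congr1 negb (hP (sval x))) (svalP x)).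

Definition goi_hom (S T : signed) := pos S + neg T -> option (neg S + pos T).

Definition goi_id (S : signed) : goi_hom S S := fun x =>
  match x with inl p => Some (inr p) | inr n => Some (inl n) end.
Arguments goi_id S x : clear implicits.

(* The current value along a path from S to U through T: either an exit leaf,
   in S^- + U^+, or an internal leaf, in T^+ + T^-. *)
Definition goi_state (S T U : signed) : Type :=
  (neg S + pos U) + (pos T + neg T).

Definition after_left {S T U : signed} (v : neg S + pos T) : goi_state S T U :=
  match v with inl n => inl (inl n) | inr p => inr (inl p) end.

Definition after_right {S T U : signed} (v : neg T + pos U) : goi_state S T U :=
  match v with inl n => inr (inr n) | inr p => inl (inr p) end.

Definition goi_start {S T U : signed} (f : goi_hom S T) (g : goi_hom T U)
    (x : pos S + neg U) : option (goi_state S T U) :=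
  match x with
  | inl p => omap after_left (f (inl p))
  | inr n => omap after_right (g (inr n))
  end.

Definition goi_next {S T U : signed} (f : goi_hom S T) (g : goi_hom T U)
    (t : pos T + neg T) : option (goi_state S T U) :=
  match t with
  | inl p => omap after_right (g (inl p))
  | inr n => omap after_left (f (inr n))
  end.

Inductive goi_result {S T U : signed} (f : goi_hom S T) (g : goi_hom T U) :
    goi_state S T U -> neg S + pos U -> Prop :=
| goi_stop y : goi_result f g (inl y) y
| goi_go t c y :
    goi_next f g t = Some c -> goi_result f g c y -> goi_result f g (inr t) y.

Definition goi_path {S T U : signed} (f : goi_hom S T) (g : goi_hom T U)
    (x : pos S + neg U) (y : neg S + pos U) : Prop :=
  exists2 c, goi_start f g x = Some c & goi_result f g c y.

Definition goi_comp {S T U : signed} (f : goi_hom S T) (g : goi_hom T U) :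
    goi_hom S U := fun x =>
  match pselect (exists y, goi_path f g x y) with
  | left e => Some (sval (cid e))
  | right _ => None
  end.

Lemma goi_result_exit (S T U : signed) (f : goi_hom S T) (g : goi_hom T U) y z :
  goi_result f g (inl y) z -> y = z.
Proof. by move=> r; inversion r. Qed.

Lemma goi_result_next (S T U : signed) (f : goi_hom S T) (g : goi_hom T U) t z :
  goi_result f g (inr t) z ->
  exists2 c, goi_next f g t = Some c & goi_result f g c z.
Proof. by move=> r; inversion r; subst; exists c. Qed.

Lemma goi_result_fun (S T U : signed) (f : goi_hom S T) (g : goi_hom T U) c y z :
  goi_result f g c y -> goi_result f g c z -> y = z.
Proof.
move=> r; elim: r z => {c y} [y z /goi_result_exit //|t c y e _ IH z].
by move=> /goi_result_next[c']; rewrite e => -[<-] /IH.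
Qed.

Lemma goi_compP (S T U : signed) (f : goi_hom S T) (g : goi_hom T U) x y :
  goi_comp f g x = Some y <-> goi_path f g x y.
Proof.
rewrite /goi_comp; case: pselect => [e|ne]; last first.
  by split => // p; case: ne; exists y.
case: (cid e) => z /= [c cE rc]; split => [[<-]|[c' c'E rc']]; first by exists c.
move: c'E; rewrite cE => -[cc']; subst c'.
by rewrite (goi_result_fun rc rc').
Qed.

Lemma goi_homP (S T : signed) (f g : goi_hom S T) :
  (forall x y, f x = Some y <-> g x = Some y) -> f = g.
Proof.
move=> fg; apply: funext => x; case fx: (f x) => [y|].
  by symmetry; apply/fg.
by case gx: (g x) => [y|] //; move/fg: gx; rewrite fx.
Qed.

Lemma goi_idl (S T : signed) (f : goi_hom S T) : goi_comp (goi_id S) f = f.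
Proof.
have run y : goi_result (goi_id S) f (after_right y) y.
  case: y => [n|q]; last exact: goi_stop.
  by apply: goi_go => //=; exact: goi_stop.
have run' y z : goi_result (goi_id S) f (after_right y) z -> y = z.
  exact: goi_result_fun.
apply: goi_homP => -[p|n] y; rewrite goi_compP /goi_path /=.
  split=> [[c [<-]] /goi_result_next[c' /=]|e].
    by case: (f (inl p)) => //= z [<-] /run' ->.
  exists (inr (inl p)) => //.
  by apply: goi_go (run y); rewrite /= e.
split=> [[c]|e]; last by exists (after_right y); rewrite ?e.
by case: (f (inr n)) => //= z [<-] /run' ->.
Qed.

Lemma goi_idr (S T : signed) (f : goi_hom S T) : goi_comp f (goi_id T) = f.
Proof.
have run y : goi_result f (goi_id T) (after_left y) y.
  case: y => [n|q]; first exact: goi_stop.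
  by apply: goi_go => //=; exact: goi_stop.
have run' y z : goi_result f (goi_id T) (after_left y) z -> y = z.
  exact: goi_result_fun.
apply: goi_homP => -[p|n] y; rewrite goi_compP /goi_path /=.
  split=> [[c]|e]; last by exists (after_left y); rewrite ?e.
  by case: (f (inl p)) => //= z [<-] /run' ->.
split=> [[c [<-]] /goi_result_next[c' /=]|e].
  by case: (f (inr n)) => //= z [<-] /run' ->.
exists (inr (inr n)) => //.
by apply: goi_go (run y); rewrite /= e.
Qed.

(* Associativity: both bracketings compute the same three-way interaction. *)
Definition goi3_state (S T U W : signed) : Type :=
  (neg S + pos W) + ((pos T + neg T) + (pos U + neg U)).

Definition after1 {S T U W : signed} (v : neg S + pos T) : goi3_state S T U W :=
  match v with inl n => inl (inl n) | inr p => inr (inl (inl p)) end.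
Definition after2 {S T U W : signed} (v : neg T + pos U) : goi3_state S T U W :=
  match v with inl n => inr (inl (inr n)) | inr p => inr (inr (inl p)) end.
Definition after3 {S T U W : signed} (v : neg U + pos W) : goi3_state S T U W :=
  match v with inl n => inr (inr (inr n)) | inr p => inl (inr p) end.

Definition goi3_start {S T U W : signed} (f : goi_hom S T) (h : goi_hom U W)
    (x : pos S + neg W) : option (goi3_state S T U W) :=
  match x with
  | inl p => omap after1 (f (inl p))
  | inr n => omap after3 (h (inr n))
  end.

Definition goi3_next {S T U W : signed} (f : goi_hom S T) (g : goi_hom T U)
    (h : goi_hom U W) (t : (pos T + neg T) + (pos U + neg U)) :
    option (goi3_state S T U W) :=
  match t with
  | inl (inl p) => omap after2 (g (inl p))
  | inl (inr n) => omap after1 (f (inr n))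
  | inr (inl p) => omap after3 (h (inl p))
  | inr (inr n) => omap after2 (g (inr n))
  end.

Inductive goi3_result {S T U W : signed} (f : goi_hom S T) (g : goi_hom T U)
    (h : goi_hom U W) : goi3_state S T U W -> neg S + pos W -> Prop :=
| goi3_stop y : goi3_result f g h (inl y) y
| goi3_go t c y : goi3_next f g h t = Some c -> goi3_result f g h c y ->
    goi3_result f g h (inr t) y.

Definition goi3_path {S T U W : signed} (f : goi_hom S T) (g : goi_hom T U)
    (h : goi_hom U W) x y : Prop :=
  exists2 c, goi3_start f h x = Some c & goi3_result f g h c y.

Lemma goi3_pathl (S T U W : signed) (f : goi_hom S T) (g : goi_hom T U)
    (h : goi_hom U W) x z :
  goi_path (goi_comp f g) h x z <-> goi3_path f g h x z.
Proof.
pose emb (c : goi_state S T U) : goi3_state S T U W := match c with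
  | inl (inl n) => inl (inl n) | inl (inr p) => inr (inr (inl p))
  | inr t => inr (inl t) end.
pose emb' (c : goi_state S U W) : goi3_state S T U W := match c with
  | inl y => inl y | inr t => inr (inr t) end.
have run c y : goi_result f g c y ->
    goi3_result f g h (emb (inl y)) z -> goi3_result f g h (emb c) z.
  elim=> {c y} // t c y e _ IH /IH r; apply: goi3_go r.
  case: t e => [p|n] /=.
    by case: (g _) => [[m|q]|] //= -[<-].
  by case: (f _) => [[m|q]|] //= -[<-].
have run' c : goi_result (goi_comp f g) h c z -> goi3_result f g h (emb' c) z.
  move=> r; elim: r run => {c z} [y _|t c z e _ IH run]; first exact: goi3_stop.
  have {}IH := IH run.
  case: t e => [p|n] /=.
    move=> e; apply: goi3_go IH => /=.
    by case: (h _) e => [[m|q]|] //= -[<-].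
  case fgE: (goi_comp f g (inr n)) => [y|] //= -[cE]; subst c.
  move/goi_compP: fgE => [c cE rc].
  have r : goi3_result f g h (emb c) z.
    by apply: run rc _; case: (y) IH.
  apply: goi3_go r => /=.
  by move: cE => /=; case: (g _) => [[m|q]|] //= -[<-].
have nur w : goi3_result f g h w z -> match w with
    | inl y => y = z
    | inr (inl t) => exists2 y, goi_result f g (inr t) y &
        goi_result (goi_comp f g) h (after_left y) z
    | inr (inr t) => goi_result (goi_comp f g) h (inr t) z end.
  move=> {run run'}; elim=> {w z} // t c z e _ IH.
  case: t e => [[p|n]|[p|n]] /=.
  - case gE: (g _) => [[m|q]|] //= -[?]; subst c.
      by case: IH => y r1 r2; exists y => //; apply: goi_go r1; rewrite /= gE.
    exists (inr q) => //; apply: (@goi_go _ _ _ _ _ _ (inl (inr q))).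
      by rewrite /= gE.
    exact: goi_stop.
  - case fE: (f _) => [[m|q]|] //= -[?]; subst c.
      exists (inl m); last by rewrite -IH; exact: goi_stop.
      apply: (@goi_go _ _ _ _ _ _ (inl (inl m))); first by rewrite /= fE.
      exact: goi_stop.
    by case: IH => y r1 r2; exists y => //; apply: goi_go r1; rewrite /= fE.
  - case hE: (h _) => [[m|q]|] //= -[?]; subst c.
      by apply: goi_go IH; rewrite /= hE.
    rewrite -IH; apply: (@goi_go _ _ _ _ _ _ (inl (inr q))); last exact: goi_stop.
    by rewrite /= hE.
  - case gE: (g _) => [[m|q]|] //= -[?]; subst c.
      case: IH => y r1 r2; apply: goi_go r2 => /=.
      suff -> : goi_comp f g (inr n) = Some y by [].
      by apply/goi_compP; exists (inr (inr m)) => //=; rewrite gE.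
    apply: (@goi_go _ _ _ _ _ _ (after_left (inr q))) => //=.
    suff -> : goi_comp f g (inr n) = Some (inr q) by [].
    apply/goi_compP; exists (inl (inr q)); last exact: goi_stop.
    by rewrite /= gE.
split; case: x => [p|n] [c cE r].
- move: cE => /=; case fgE: (goi_comp f g (inl p)) => [y|] //= -[?]; subst c.
  move/goi_compP: fgE => [c cE rc]; exists (emb c).
    by move: cE => /=; case: (f _) => [[m|q]|] //= -[<-].
  by apply: run rc _; move/run': r; case: (y).
- exists (emb' c); last exact: run'.
  by move: cE => /=; case: (h _) => [[m|q]|] //= -[<-].
- move: cE => /=; case fE: (f _) => [[m|q]|] //= -[?]; subst c.
    have /= <- := nur _ r; exists (inl (inl m)); last exact: goi_stop.
    rewrite /=; suff -> : goi_comp f g (inl p) = Some (inl m) by [].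
    apply/goi_compP; exists (inl (inl m)); last exact: goi_stop.
    by rewrite /= fE.
  have /= [y r1 r2] := nur _ r; exists (after_left y) => //=.
  suff -> : goi_comp f g (inl p) = Some y by [].
  by apply/goi_compP; exists (inr (inl q)) => //=; rewrite fE.
- move: cE => /=; case hE: (h _) => [[m|q]|] //= -[?]; subst c.
    by exists (inr (inr m)); [rewrite /= hE | exact: (nur _ r)].
  have /= <- := nur _ r; exists (inl (inr q)); last exact: goi_stop.
  by rewrite /= hE.
Qed.

Lemma goi3_pathr (S T U W : signed) (f : goi_hom S T) (g : goi_hom T U)
    (h : goi_hom U W) x z :
  goi_path f (goi_comp g h) x z <-> goi3_path f g h x z.
Proof.
pose emb (c : goi_state T U W) : goi3_state S T U W := match c with
  | inl (inl n) => inr (inl (inr n)) | inl (inr p) => inl (inr p)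
  | inr t => inr (inr t) end.
pose emb' (c : goi_state S T W) : goi3_state S T U W := match c with
  | inl y => inl y | inr t => inr (inl t) end.
have run c y : goi_result g h c y ->
    goi3_result f g h (emb (inl y)) z -> goi3_result f g h (emb c) z.
  elim=> {c y} // t c y e _ IH /IH r; apply: goi3_go r.
  case: t e => [p|n] /=.
    by case: (h _) => [[m|q]|] //= -[<-].
  by case: (g _) => [[m|q]|] //= -[<-].
have run' c : goi_result f (goi_comp g h) c z -> goi3_result f g h (emb' c) z.
  move=> r; elim: r run => {c z} [y _|t c z e _ IH run]; first exact: goi3_stop.
  have {}IH := IH run.
  case: t e => [n|p] /=; last first.
    move=> e; apply: goi3_go IH => /=.
    by case: (f _) e => [[m|q]|] //= -[<-].
  case fgE: (goi_comp g h (inl n)) => [y|] //= -[cE]; subst c.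
  move/goi_compP: fgE => [c cE rc].
  have r : goi3_result f g h (emb c) z.
    by apply: run rc _; case: (y) IH.
  apply: goi3_go r => /=.
  by move: cE => /=; case: (g _) => [[m|q]|] //= -[<-].
have nur w : goi3_result f g h w z -> match w with
    | inl y => y = z
    | inr (inr t) => exists2 y, goi_result g h (inr t) y &
        goi_result f (goi_comp g h) (after_right y) z
    | inr (inl t) => goi_result f (goi_comp g h) (inr t) z end.
  move=> {run run'}; elim=> {w z} // t c z e _ IH.
  case: t e => [[p|n]|[p|n]] /=.
  - case gE: (g _) => [[m|q]|] //= -[?]; subst c; last first.
      case: IH => y r1 r2; apply: goi_go r2 => /=.
      suff -> : goi_comp g h (inl p) = Some y by [].
      by apply/goi_compP; exists (inr (inl q)) => //=; rewrite gE.
    apply: (@goi_go _ _ _ _ _ _ (after_right (inl m))) => //=.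
    suff -> : goi_comp g h (inl p) = Some (inl m) by [].
    apply/goi_compP; exists (inl (inl m)); last exact: goi_stop.
    by rewrite /= gE.
  - case fE: (f _) => [[m|q]|] //= -[?]; subst c; last first.
      by apply: goi_go IH; rewrite /= fE.
    rewrite -IH; apply: (@goi_go _ _ _ _ _ _ (inl (inl m))); last exact: goi_stop.
    by rewrite /= fE.
  - case hE: (h _) => [[m|q]|] //= -[?]; subst c; last first.
      exists (inr q); last by rewrite -IH; exact: goi_stop.
      apply: (@goi_go _ _ _ _ _ _ (inl (inr q))); first by rewrite /= hE.
      exact: goi_stop.
    by case: IH => y r1 r2; exists y => //; apply: goi_go r1; rewrite /= hE.
  - case gE: (g _) => [[m|q]|] //= -[?]; subst c; last first.
      by case: IH => y r1 r2; exists y => //; apply: goi_go r1; rewrite /= gE.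
    exists (inl m) => //; apply: (@goi_go _ _ _ _ _ _ (inl (inl m))).
      by rewrite /= gE.
    exact: goi_stop.
split; case: x => [n|p] [c cE r].
- exists (emb' c); last exact: run'.
  by move: cE => /=; case: (f _) => [[m|q]|] //= -[<-].
- move: cE => /=; case fgE: (goi_comp g h (inr p)) => [y|] //= -[?]; subst c.
  move/goi_compP: fgE => [c cE rc]; exists (emb c).
    by move: cE => /=; case: (h _) => [[m|q]|] //= -[<-].
  by apply: run rc _; move/run': r; case: (y).
- move: cE => /=; case fE: (f _) => [[m|q]|] //= -[?]; subst c.
    have /= <- := nur _ r; exists (inl (inl m)); last exact: goi_stop.
    by rewrite /= fE.
  by exists (inr (inl q)); [rewrite /= fE | exact: (nur _ r)].
- move: cE => /=; case hE: (h _) => [[m|q]|] //= -[?]; subst c; last first.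
    have /= <- := nur _ r; exists (inl (inr q)); last exact: goi_stop.
    rewrite /=; suff -> : goi_comp g h (inr p) = Some (inr q) by [].
    apply/goi_compP; exists (inl (inr q)); last exact: goi_stop.
    by rewrite /= hE.
  have /= [y r1 r2] := nur _ r; exists (after_right y) => //=.
  suff -> : goi_comp g h (inr p) = Some y by [].
  by apply/goi_compP; exists (inr (inr m)) => //=; rewrite hE.
Qed.

Lemma goi_compA (S T U W : signed) (f : goi_hom S T) (g : goi_hom T U)
    (h : goi_hom U W) :
  goi_comp f (goi_comp g h) = goi_comp (goi_comp f g) h.
Proof.
by apply: goi_homP => x y; rewrite !goi_compP goi3_pathl goi3_pathr.
Qed.

Definition GoI_Setp : category goi_hom :=
  Category goi_idl goi_idr goi_compA.

Inductive atom (V : Type) := Var (P : V) | Dual (P : V) | One | Bot.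
Arguments One {V}.
Arguments Bot {V}.

Inductive formula (V : Type) :=
| Atom (a : atom V)
| Tensor (A B : formula V)
| Par (A B : formula V).

Definition dual_atom {V} (a : atom V) : atom V :=
  match a with Var P => Dual P | Dual P => Var P | One => Bot | Bot => One end.

Fixpoint dual {V} (A : formula V) : formula V :=
  match A with
  | Atom a => Atom (dual_atom a)
  | Tensor B C => Par (dual B) (dual C)
  | Par B C => Tensor (dual B) (dual C)
  end.

Definition positive_atom {V} (a : atom V) : bool :=
  match a with Var _ | One => true | Dual _ | Bot => false end.

Fixpoint leaf {V} (A : formula V) : finType :=
  match A with
  | Atom _ => unit
  | Tensor B C | Par B C => (leaf B + leaf C)%type
  end.

Fixpoint label {V} (A : formula V) : leaf A -> atom V :=
  match A with
  | Atom a => fun _ => a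
  | Tensor B C | Par B C =>
      fun l => match l with inl l => label l | inr l => label l end
  end.

Definition leaves {V} (A : formula V) : signed :=
  @Signed (leaf A) (fun l => positive_atom (label l)).

(* The i-th leaf of [dual A] corresponds to the i-th leaf of A. *)
Fixpoint dual_leaf {V} (A : formula V) : leaf A -> leaf (dual A) :=
  match A with
  | Atom _ => fun l => l
  | Tensor B C | Par B C => fun l =>
      match l with inl l => inl (dual_leaf l) | inr l => inr (dual_leaf l) end
  end.

Fixpoint undual_leaf {V} (A : formula V) : leaf (dual A) -> leaf A :=
  match A with
  | Atom _ => fun l => l
  | Tensor B C | Par B C => fun l =>
      match l with inl l => inl (undual_leaf l) | inr l => inr (undual_leaf l) end
  end.

Lemma dual_leafK V (A : formula V) : cancel (@dual_leaf V A) (@undual_leaf V A).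
Proof. by elim: A => [//|B IHB C IHC|B IHB C IHC] [l|l] /=; rewrite ?IHB ?IHC. Qed.

Lemma undual_leafK V (A : formula V) : cancel (@undual_leaf V A) (@dual_leaf V A).
Proof. by elim: A => [//|B IHB C IHC|B IHB C IHC] [l|l] /=; rewrite ?IHB ?IHC. Qed.

Lemma positive_dual V (A : formula V) (l : leaf A) :
  positive (dual_leaf l : leaves (dual A)) = ~~ positive (l : leaves A).
Proof.
elim: A l => [a l|B IHB C IHC [l|l]|B IHB C IHC [l|l]]; last 4 first.
- exact: IHB.
- exact: IHC.
- exact: IHB.
- exact: IHC.
by case: a l.
Qed.

Lemma positive_undual V (A : formula V) (l : leaf (dual A)) :
  positive (undual_leaf l : leaves A) = ~~ positive (l : leaves (dual A)).
Proof. by rewrite -{2}(undual_leafK l) positive_dual negbK. Qed.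

(* Vertices of the parse tree; [None] is the root of a compound formula. *)
Fixpoint vertex {V} (A : formula V) : finType :=
  match A with
  | Atom _ => unit
  | Tensor B C | Par B C => option (vertex B + vertex C)
  end.

Definition root {V} (A : formula V) : vertex A :=
  match A with Atom _ => tt | Tensor _ _ | Par _ _ => None end.

Fixpoint leaf_vertex {V} (A : formula V) : leaf A -> vertex A :=
  match A with
  | Atom _ => fun l => l
  | Tensor B C | Par B C => fun l => match l with
      | inl l => Some (inl (leaf_vertex l)) | inr l => Some (inr (leaf_vertex l))
      end
  end.

Fixpoint is_par {V} (A : formula V) : vertex A -> bool :=
  match A with
  | Atom _ => fun _ => false
  | Tensor B C => fun v => match v with
      | None => false | Some (inl v) => is_par v | Some (inr v) => is_par v end
  | Par B C => fun v => match v with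
      | None => true | Some (inl v) => is_par v | Some (inr v) => is_par v end
  end.

(* Argument edges; [inl false] and [inl true] are the left and right argument
   edges of the root connective. *)
Fixpoint edge {V} (A : formula V) : finType :=
  match A with
  | Atom _ => void
  | Tensor B C | Par B C => (bool + (edge B + edge C))%type
  end.

Fixpoint side {V} (A : formula V) : edge A -> bool :=
  match A with
  | Atom _ => fun _ => false
  | Tensor B C | Par B C => fun e => match e with
      | inl b => b | inr (inl e) => side e | inr (inr e) => side e end
  end.

Fixpoint parent {V} (A : formula V) : edge A -> vertex A :=
  match A with
  | Atom _ => fun _ => tt
  | Tensor B C | Par B C => fun e => match e with
      | inl _ => None
      | inr (inl e) => Some (inl (parent e))
      | inr (inr e) => Some (inr (parent e)) end
  end.

Fixpoint child {V} (A : formula V) : edge A -> vertex A :=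
  match A with
  | Atom _ => fun _ => tt
  | Tensor B C | Par B C => fun e => match e with
      | inl false => Some (inl (root B))
      | inl true => Some (inr (root C))
      | inr (inl e) => Some (inl (child e))
      | inr (inr e) => Some (inr (child e)) end
  end.

Inductive sequent (V : Type) :=
| Single (A : formula V)
| Add (A : formula V) (G : sequent V).

(* [cuts] lists one formula A for each cut pair A, A^bot. *)
Record cut_sequent (V : Type) :=
  CutSequent { concl : sequent V; cuts : seq (formula V) }.

Fixpoint sequent_sum {V} (T : formula V -> finType) (G : sequent V) : finType :=
  match G with
  | Single A => T A
  | Add A G => (T A + sequent_sum T G)%type
  end.

Fixpoint cuts_sum {V} (T : formula V -> finType) (D : seq (formula V)) : finType :=
  match D with
  | [::] => void
  | A :: D => ((T A + T (dual A)) + cuts_sum T D)%type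
  end.

(* The disjoint union of the T A for A ranging over the formula occurrences,
   cut pairs included; used with T one of [leaf], [vertex], [edge]. *)
Definition occ_sum {V} (T : formula V -> finType) (G : cut_sequent V) : finType :=
  (sequent_sum T (concl G) + cuts_sum T (cuts G))%type.

Fixpoint sequent_case {V} {T : formula V -> finType} {X : Type}
    (h : forall A, T A -> X) (G : sequent V) : sequent_sum T G -> X :=
  match G with
  | Single A => h A
  | Add A G => fun x => match x with inl x => h A x | inr x => sequent_case h x end
  end.

Fixpoint cuts_case {V} {T : formula V -> finType} {X : Type}
    (h : forall A, T A -> X) (D : seq (formula V)) : cuts_sum T D -> X :=
  match D with
  | [::] => fun x => match x with end
  | A :: D => fun x => match x with
      | inl (inl x) => h A x
      | inl (inr x) => h (dual A) x
      | inr x => cuts_case h x end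
  end.

Definition occ_case {V} {T : formula V -> finType} {X : Type}
    (h : forall A, T A -> X) {G : cut_sequent V} (x : occ_sum T G) : X :=
  match x with inl x => sequent_case h x | inr x => cuts_case h x end.

Fixpoint sequent_map {V} {T T' : formula V -> finType}
    (h : forall A, T A -> T' A) (G : sequent V) :
    sequent_sum T G -> sequent_sum T' G :=
  match G with
  | Single A => h A
  | Add A G => fun x =>
      match x with inl x => inl (h A x) | inr x => inr (sequent_map h x) end
  end.

Fixpoint cuts_map {V} {T T' : formula V -> finType}
    (h : forall A, T A -> T' A) (D : seq (formula V)) :
    cuts_sum T D -> cuts_sum T' D :=
  match D with
  | [::] => fun x => x
  | A :: D => fun x => match x with
      | inl (inl x) => inl (inl (h A x))
      | inl (inr x) => inl (inr (h (dual A) x))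
      | inr x => inr (cuts_map h x) end
  end.

Definition occ_map {V} {T T' : formula V -> finType}
    (h : forall A, T A -> T' A) {G : cut_sequent V} (x : occ_sum T G) :
    occ_sum T' G :=
  match x with inl x => inl (sequent_map h x) | inr x => inr (cuts_map h x) end.

Definition occ_label {V} {G : cut_sequent V} (l : occ_sum leaf G) : atom V :=
  occ_case (@label V) l.

Definition occ_leaves {V} (G : cut_sequent V) : signed :=
  @Signed (occ_sum leaf G) (fun l => positive_atom (occ_label l)).

Fixpoint cut_edge {V} (D : seq (formula V)) : finType :=
  match D with [::] => void | _ :: D => option (cut_edge D) end.

Fixpoint cut_ends {V} (D : seq (formula V)) :
    cut_edge D -> cuts_sum vertex D * cuts_sum vertex D :=
  match D with
  | [::] => fun e => match e with end
  | A :: D => fun e => match e with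
      | None => (inl (inl (root A)), inl (inr (root (dual A))))
      | Some e => (inr (cut_ends e).1, inr (cut_ends e).2) end
  end.

Record multigraph := Multigraph {
  gvertex : finType;
  gedge : finType;
  ends : gedge -> gvertex * gvertex }.

Definition joins (X : multigraph) (e : gedge X) (u v : gvertex X) : bool :=
  (ends e == (u, v)) || (ends e == (v, u)).

(* A walk from u is given by the successive (edge, vertex reached) pairs. *)
Fixpoint is_walk (X : multigraph) (u : gvertex X)
    (w : seq (gedge X * gvertex X)) : bool :=
  match w with
  | [::] => true
  | (e, v) :: w => joins e u v && is_walk v w
  end.

Definition walk_end (X : multigraph) (u : gvertex X)
    (w : seq (gedge X * gvertex X)) : gvertex X := last u (unzip2 w).

Definition connected_graph (X : multigraph) : Prop :=
  forall u v : gvertex X, exists2 w, is_walk u w & walk_end u w = v.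

(* Two distinct parallel edges form a cycle of length 2, a loop one of length 1. *)
Definition is_cycle (X : multigraph) (u : gvertex X)
    (w : seq (gedge X * gvertex X)) : Prop :=
  [/\ w <> [::], is_walk u w, walk_end u w = u, uniq (unzip1 w) & uniq (unzip2 w)].

Definition is_tree (X : multigraph) : Prop :=
  connected_graph X /\ forall u w, ~ @is_cycle X u w.

Definition leaf_fun {V} (G : cut_sequent V) :=
  neg (occ_leaves G) -> pos (occ_leaves G).

(* A switching is encoded by a choice s of a side at each vertex, of which only
   the values at par vertices matter; [s v] is the side of the argument edge
   that is kept. *)
Definition kept {V} {G : cut_sequent V} (s : occ_sum vertex G -> bool)
    (e : occ_sum edge G) : bool :=
  occ_case (@is_par V) (occ_map (@parent V) e) ==>
    (occ_case (@side V) e == s (occ_map (@parent V) e)).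

(* The edges of a switching (kept argument edges and cuts), together with one
   edge {l, f(l)} for each negative leaf l. *)
Definition switching_graph {V} {G : cut_sequent V} (f : leaf_fun G)
    (s : occ_sum vertex G -> bool) : multigraph :=
  @Multigraph (occ_sum vertex G)
    (({e : occ_sum edge G | kept s e} + cut_edge (cuts G)) +
     {l : occ_sum leaf G | ~~ positive_atom (occ_label l)})%type
    (fun e => match e with
     | inl (inl e) =>
         (occ_map (@parent V) (sval e), occ_map (@child V) (sval e))
     | inl (inr c) => (inr (cut_ends c).1, inr (cut_ends c).2)
     | inr l =>
         (occ_map (@leaf_vertex V) (sval l), occ_map (@leaf_vertex V) (sval (f l)))
     end).

Definition matching {V} {G : cut_sequent V} (f : leaf_fun G) : Prop :=
  forall P : V,
    set_bij [set n : neg (occ_leaves G) | occ_label (sval n) = Dual P]%classic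
            [set p : pos (occ_leaves G) | occ_label (sval p) = Var P]%classic f.

Definition is_proof_net {V} {G : cut_sequent V} (f : leaf_fun G) : Prop :=
  matching f /\ forall s, is_tree (switching_graph f s).

(* One step of cut elimination at the level of the cut pairs. As a cut pair is
   unordered, a cut on B par C, i.e. on the tensor of B^bot and C^bot, is
   replaced by cuts on B and C. *)
Inductive cut_step {V} : seq (formula V) -> seq (formula V) -> Type :=
| AtomCut a D : cut_step (Atom a :: D) D
| TensorCut B C D : cut_step (Tensor B C :: D) [:: B, C & D]
| ParCut B C D : cut_step (Par B C :: D) [:: B, C & D]
| LaterCut A D D' : cut_step D D' -> cut_step (A :: D) (A :: D').

Definition split_cut (B C B' C' R : Type) (x : (B + B') + ((C + C') + R)) :
    ((B + C) + (B' + C')) + R :=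
  match x with
  | inl (inl b) => inl (inl (inl b))
  | inl (inr b) => inl (inr (inl b))
  | inr (inl (inl c)) => inl (inl (inr c))
  | inr (inl (inr c)) => inl (inr (inr c))
  | inr (inr r) => inr r
  end.

(* The leaf before the step of which a given leaf after the step is the copy. *)
Fixpoint cuts_residual {V} {D D' : seq (formula V)} (s : cut_step D D') :
    cuts_sum leaf D' -> cuts_sum leaf D :=
  match s in cut_step D D' return cuts_sum leaf D' -> cuts_sum leaf D with
  | AtomCut _ _ => fun l => inr l
  | TensorCut _ _ _ => fun l => split_cut l
  | ParCut _ _ _ => fun l => split_cut l
  | LaterCut _ _ _ s => fun l =>
      match l with inl l => inl l | inr l => inr (cuts_residual s l) end
  end.

Definition residual {V} {G : sequent V} {D D' : seq (formula V)}
    (s : cut_step D D') (l : occ_leaves (CutSequent G D')) :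
    occ_leaves (CutSequent G D) :=
  match l with inl l => inl l | inr l => inr (cuts_residual s l) end.

(* The two leaves of the cut pair that is deleted, if the step is atomic. *)
Fixpoint cuts_deleted {V} {D D' : seq (formula V)} (s : cut_step D D') :
    cuts_sum leaf D -> bool :=
  match s in cut_step D D' return cuts_sum leaf D -> bool with
  | AtomCut _ _ => fun l => match l with inl _ => true | inr _ => false end
  | TensorCut _ _ _ | ParCut _ _ _ => fun _ => false
  | LaterCut _ _ _ s => fun l =>
      match l with inl _ => false | inr l => cuts_deleted s l end
  end.

Definition deleted {V} {G : sequent V} {D D' : seq (formula V)}
    (s : cut_step D D') (l : occ_leaves (CutSequent G D)) : bool :=
  match l with inl _ => false | inr l => cuts_deleted s l end.

Lemma residual_label V (G : sequent V) (D D' : seq (formula V))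
    (s : cut_step D D') (l : occ_leaves (CutSequent G D')) :
  occ_label (residual s l) = occ_label l.
Proof.
case: l => [//|]; elim: s => {D D'} [a D|B C D|B C D|A D D' s IH] //=.
- by case=> [[]|[[]|]].
- by case=> [[]|[[]|]].
- by case=> [[l|l]|l] //; exact: IH.
Qed.

Lemma residual_sign V (G : sequent V) (D D' : seq (formula V))
    (s : cut_step D D') : sign_preserving (@residual V G D D' s).
Proof. by move=> l; rewrite /= residual_label. Qed.

(* In the atomic case the edges of f targeting
   the positive deleted leaf are reset to the target of the negative one. *)
Definition eliminates {V} {G : sequent V} {D D' : seq (formula V)}
    (s : cut_step D D') (f : leaf_fun (CutSequent G D))
    (f' : leaf_fun (CutSequent G D')) : Prop :=
  forall n,
    let p := f (neg_map (@residual_sign V G D D' s) n) in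
    let p' := pos_map (@residual_sign V G D D' s) (f' n) in
    if deleted s (sval p)
    then exists2 m : neg (occ_leaves (CutSequent G D)),
           deleted s (sval m) & p' = f m
    else p' = p.

Definition net {V} (G : sequent V) :=
  {D : seq (formula V) & leaf_fun (CutSequent G D)}.

Definition elim_step {V} {G : sequent V} (x y : net G) : Prop :=
  exists s : cut_step (projT1 x) (projT1 y), eliminates s (projT2 x) (projT2 y).

Definition is_normal_form {V} {G : sequent V} (x : net G)
    (h : leaf_fun (CutSequent G [::])) : Prop :=
  clos_refl_trans (net G) elim_step x
    (existT (fun D => leaf_fun (CutSequent G D)) [::] h).

Definition hom_sequent {V} (A B : formula V) : sequent V :=
  Add (dual A) (Single B).

Definition hom_cut_sequent {V} (A B : formula V) : cut_sequent V :=
  CutSequent (hom_sequent A B) [::].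

Definition net_hom {V} (A B : formula V) :=
  {f : leaf_fun (hom_cut_sequent A B) | is_proof_net f}.

Definition id_leaf {V} (A : formula V) (l : occ_sum leaf (hom_cut_sequent A A)) :
    occ_sum leaf (hom_cut_sequent A A) :=
  match l with
  | inl (inl l) => inl (inr (undual_leaf l))
  | inl (inr l) => inl (inl (dual_leaf l))
  | inr e => inr e
  end.

Lemma id_leaf_sign V (A : formula V) (l : occ_leaves (hom_cut_sequent A A)) :
  positive (id_leaf l : occ_leaves (hom_cut_sequent A A)) = ~~ positive l.
Proof.
by case: l => [[l|l]|[]]; [exact: positive_undual | exact: positive_dual].
Qed.

Definition id_net {V} (A : formula V) : leaf_fun (hom_cut_sequent A A) :=
  fun n => exist _ (id_leaf (sval n)) (etrans (id_leaf_sign (sval n)) (svalP n)).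
Arguments id_net {V} A n.

Definition comp_sequent {V} (A B C : formula V) : cut_sequent V :=
  CutSequent (hom_sequent A C) [:: B].

Definition comp_left {V} {A B C : formula V}
    (l : occ_leaves (hom_cut_sequent A B)) : occ_leaves (comp_sequent A B C) :=
  match l with
  | inl (inl a) => inl (inl a)
  | inl (inr b) => inr (inl (inl b))
  | inr e => match e with end
  end.

Definition comp_right {V} {A B C : formula V}
    (l : occ_leaves (hom_cut_sequent B C)) : occ_leaves (comp_sequent A B C) :=
  match l with
  | inl (inl b) => inr (inl (inr b))
  | inl (inr c) => inl (inr c)
  | inr e => match e with end
  end.

Lemma comp_left_sign V (A B C : formula V) :
  sign_preserving (@comp_left V A B C).
Proof. by case=> [[]|[]]. Qed.

Lemma comp_right_sign V (A B C : formula V) :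
  sign_preserving (@comp_right V A B C).
Proof. by case=> [[]|[]]. Qed.

Definition union_net {V} {A B C : formula V}
    (f : leaf_fun (hom_cut_sequent A B)) (g : leaf_fun (hom_cut_sequent B C)) :
    leaf_fun (comp_sequent A B C) := fun n =>
  let: exist l ln := n in
  let L := pos_map (@comp_left_sign V A B C) in
  let R := pos_map (@comp_right_sign V A B C) in
  match l return ~~ @positive (occ_leaves (comp_sequent A B C)) l -> _ with
  | inl (inl a) => fun h => L (f (exist _ (inl (inl a)) h))
  | inl (inr c) => fun h => R (g (exist _ (inl (inr c)) h))
  | inr (inl (inl b)) => fun h => L (f (exist _ (inl (inr b)) h))
  | inr (inl (inr b)) => fun h => R (g (exist _ (inl (inl b)) h))
  | inr (inr e) => match e with end
  end ln.

(* Identities and composites are determined by these conditions; that they are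
   proof nets, and that the normal form of [union_net f g] exists and is unique,
   is part of there being such a category. *)
Definition is_proof_net_category {V} (N : category (@net_hom V)) : Prop :=
  (forall A, sval (idm N A) = id_net A) /\
  (forall A B C (f : net_hom A B) (g : net_hom B C) h,
     is_normal_form
       (existT (fun D => leaf_fun (CutSequent (hom_sequent A C) D))
          [:: B] (union_net (sval f) (sval g))) h <->
     h = sval (comp N f g)).

Definition hom_source {V} {A B : formula V} (x : pos (leaves A) + neg (leaves B)) :
    neg (occ_leaves (hom_cut_sequent A B)) :=
  match x with
  | inl p => exist (fun l => ~~ @positive (occ_leaves (hom_cut_sequent A B)) l)
      (inl (inl (dual_leaf (sval p))))
      (etrans (congr1 negb (positive_dual (sval p)))
         (etrans (negbK _) (svalP p)))
  | inr n => exist (fun l => ~~ @positive (occ_leaves (hom_cut_sequent A B)) l)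
      (inl (inr (sval n))) (svalP n)
  end.

Definition hom_target {V} {A B : formula V}
    (p : pos (occ_leaves (hom_cut_sequent A B))) : neg (leaves A) + pos (leaves B) :=
  let: exist l lp := p in
  match l return @positive (occ_leaves (hom_cut_sequent A B)) l -> _ with
  | inl (inl a) => fun h => inl (exist _ (undual_leaf a)
      (etrans (congr1 negb (positive_undual a)) (etrans (negbK _) h)))
  | inl (inr b) => fun h => inr (exist _ b h)
  | inr e => match e with end
  end lp.

Definition underlying {V} (A B : formula V) (f : net_hom A B) :
    goi_hom (leaves A) (leaves B) :=
  fun x => Some (hom_target (sval f (hom_source x))).

(* Main.v *)
(* Over the two-element field, a graph is a tree iff its coboundary map, from
   2-colourings of the vertices modulo constants to 2-colourings of the edges,
   is bijective.  In this form the switching condition passes through a cut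
   elimination step by manipulating colourings, without any surgery on walks.
   Cut elimination at the head of the list of cuts thus reaches a cut-free proof
   net.  Following the leaf function across the cuts gives paths whose end is
   invariant under every elimination step: this yields both the uniqueness of
   the normal form and its agreement with path composition in GoI(Setp).  The
   underlying leaf function is a faithful image, so the category laws for proof
   nets are inherited from those of GoI(Setp). *)

From mathcomp Require Import all_boot.
From mathcomp Require Import boolp classical_sets functions.
From Stdlib Require Import Relation_Operators.
Require Import Defs.

Set Implicit Arguments.
Unset Strict Implicit.
Unset Printing Implicit Defensive.

(** * Trees as graphs with a bijective coboundary map *)

(** Solvability of every edge weighting expresses acyclicity, and rigidity (only constants have zero
    coboundary) expresses connectedness. Call a colouring flat if its coboundary is zero. The
    delicate case is the compound cut. One switching before the step keeps a single edge of the par,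
    so it controls only three of the four premises. Both switchings have to be combined, and the
    fact that the two par premises lie in one component comes from multiplying two flat colourings:
    the product is flat again. For an atomic cut, the path from the positive leaf through the cut to
    the target of the negative leaf is contracted. Since several negative leaves may share a unit as
    target, paths are followed forwards only, from a negative leaf to its target. Their invariance
    is proved from the reduct back to the original net, by expanding each reset edge. In a normal
    form every path stops at once; pulling this back along the reduction shows that the paths of the
    original net end, so the GoI composite of two proof nets is total. *)

Lemma is_walk_rcons (X : multigraph) (u v : gvertex X) w e :
  is_walk u (rcons w (e, v)) = is_walk u w && joins e (walk_end u w) v.
Proof.
elim: w u => [|[e' u'] w IH] u /=; first by rewrite andbT.
by rewrite IH andbA.
Qed.

Lemma walk_end_rcons (X : multigraph) (u v : gvertex X) w e :
  walk_end u (rcons w (e, v)) = v.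
Proof. by rewrite /walk_end /unzip2 map_rcons last_rcons. Qed.

Lemma joins_ends (X : multigraph) (e : gedge X) : joins e (ends e).1 (ends e).2.
Proof. by rewrite /joins -surjective_pairing eqxx. Qed.

Lemma joins_sym (X : multigraph) (e : gedge X) u v : joins e u v = joins e v u.
Proof. by rewrite /joins orbC. Qed.

Lemma joins_const (X : multigraph) (e : gedge X) u v (phi : gvertex X -> bool) :
  joins e u v -> phi (ends e).1 (+) phi (ends e).2 = phi u (+) phi v.
Proof. by case/orP => /eqP -> //=; rewrite addbC. Qed.

Lemma walk_const (X : multigraph) (phi : gvertex X -> bool) u w :
  (forall e, e \in unzip1 w -> phi (ends e).1 (+) phi (ends e).2 = false) ->
  is_walk u w -> phi (walk_end u w) = phi u.
Proof.
elim: w u => [//|[e v] w IH] u H /= /andP[j ww].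
rewrite [LHS](IH v) //; last by move=> e' e'w; apply: H; rewrite inE e'w orbT.
have := H e; rewrite inE eqxx => /(_ isT).
by rewrite (joins_const _ j); case: (phi u); case: (phi v).
Qed.

Lemma walk_endpoint (X : multigraph) (u : gvertex X) w e a b :
  is_walk u w -> e \in unzip1 w -> joins e a b -> a \in u :: unzip2 w.
Proof.
elim: w u => [//|[e' v] w IH] u /= /andP[j ww].
rewrite inE => /orP[/eqP ->|ew jab]; last by rewrite inE (IH v) ?orbT.
rewrite /joins; case/orP: j => /eqP ->; case/orP => /eqP[? ?]; subst;
  by rewrite !inE eqxx ?orbT.
Qed.

(** If the first edge occurred again, [walk_endpoint] would make the walk revisit its starting
    vertex. *)
Lemma walk_uniq_edges (X : multigraph) (u : gvertex X) w :
  is_walk u w -> uniq (u :: unzip2 w) -> uniq (unzip1 w).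
Proof.
elim: w u => [//|[e v] w IH] u /= /andP[j ww] /andP[uw uu].
rewrite (IH v) // andbT; apply: contra uw => ew.
exact: walk_endpoint ww ew j.
Qed.

Definition joined_avoiding (X : multigraph) (e : gedge X) : rel (gvertex X) :=
  fun u v => [exists e', (e' != e) && joins e' u v].

Lemma path_walk (X : multigraph) (e : gedge X) u p :
  path (joined_avoiding e) u p ->
  exists w, [/\ is_walk u w, unzip2 w = p & e \notin unzip1 w].
Proof.
elim: p u => [|v p IH] u /=; first by exists [::].
case/andP=> /existsP[e' /andP[ne j]] /IH[w [ww wp ew]].
by exists ((e', v) :: w); split=> /=; rewrite ?j ?wp // inE negb_or eq_sym ne.
Qed.

(** In an acyclic graph every edge is a bridge. The potential is the indicator of the vertices
    reachable from the second end of [e] without using [e]; were the first end among them, a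
    shortened path closed by [e] would be a cycle. *)
Lemma bridge_potential (X : multigraph) (e : gedge X) :
  (forall u w, ~ @is_cycle X u w) ->
  exists phi : gvertex X -> bool,
    forall e', phi (ends e').1 (+) phi (ends e').2 = (e' == e).
Proof.
move=> acyc; pose r := joined_avoiding e.
have rsym : symmetric r.
  by move=> u v; apply: eq_existsb => e'; rewrite joins_sym.
exists (connect r (ends e).2) => e'; case: eqVneq => [->|ne]; last first.
  have jr : r (ends e').1 (ends e').2.
    by apply/existsP; exists e'; rewrite ne joins_ends.
  apply/negbTE; rewrite negb_add; apply/eqP.
  by apply: (same_connect_r (sym_connect_sym rsym)); exact: connect1.
rewrite connect0 addbT; apply/negP => /connectP[p pp].
case: (shortenP pp) => p' pp' up' _ ep'.
have [w [ww wp ew]] := path_walk pp'.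
apply: (acyc (ends e).1 ((e, (ends e).2) :: w)); split => //=.
- by rewrite joins_ends.
- by rewrite /walk_end /= wp.
- by rewrite ew (walk_uniq_edges ww) ?wp.
- by rewrite wp.
Qed.

(** Sums of bridge potentials solve any weighting of an acyclic graph; conversely, a cycle obstructs
    the weighting concentrated on its first edge. A flat colouring is constant along walks, and the
    indicator of a connected component is flat. *)
Lemma is_treeP (X : multigraph) : is_tree X <->
  (forall w : gedge X -> bool, exists phi : gvertex X -> bool,
     forall e, phi (ends e).1 (+) phi (ends e).2 = w e) /\
  (forall phi : gvertex X -> bool,
     (forall e : gedge X, phi (ends e).1 (+) phi (ends e).2 = false) ->
     forall u v, phi u = phi v).
Proof.
split=> [[conn acyc]|[solv rig]]; split.
- move=> w; have /choice[phi phiE] := fun e => bridge_potential e acyc.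
  exists (fun v => \big[addb/false]_(e | w e) phi e v) => e.
  rewrite -big_split /=.
  under eq_bigr => e' _ do rewrite phiE.
  case we: (w e).
    rewrite (bigD1 e) //= eqxx big1 // => e' /andP[_ ne].
    by rewrite eq_sym (negbTE ne).
  by rewrite big1 // => e' we'; apply: contraFF we => /eqP ->.
- move=> phi H u v; have [w ww <-] := conn u v.
  by symmetry; apply: walk_const.
- move=> u v; pose phi v := `[< exists2 w, is_walk u w & walk_end u w = v >].
  have step e a b : joins e a b -> phi a -> phi b.
    move=> j /asboolP[w ww wa]; apply/asboolP; exists (rcons w (e, b)).
      by rewrite is_walk_rcons ww wa.
    exact: walk_end_rcons.
  have : phi v.
    rewrite (rig phi _ v u) => [|e]; first by apply/asboolP; exists [::].
    apply/negbTE; rewrite negb_add; apply/eqP; apply/idP/idP.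
      exact/step/joins_ends.
    by apply: step; rewrite joins_sym; exact: joins_ends.
  by move/asboolP.
- move=> u [//|[e v] w] [] // _ /= /andP[j ww] wu /andP[ew _] _.
  have [phi phiE] := solv (pred1 e).
  have : phi (walk_end v w) = phi v.
    apply: walk_const ww => e' e'w.
    by rewrite phiE /=; apply: contraNF ew => /eqP <-.
  rewrite -[walk_end v w]/(walk_end u ((e, v) :: w)) wu => uv.
  by have := phiE e; rewrite (joins_const _ j) /= eqxx uv addbb.
Qed.

(** * The switching condition in terms of colourings *)

(* [phi] has coboundary [we], [wc], [wl] along the argument edges, the cuts and
   the edges of the leaf function in the switching graph. *)
Definition coboundary {V} {G : cut_sequent V} (f : leaf_fun G)
    (s : occ_sum vertex G -> bool) (we : occ_sum edge G -> bool)
    (wc : cut_edge (cuts G) -> bool) (wl : occ_sum leaf G -> bool)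
    (phi : occ_sum vertex G -> bool) : Prop :=
  [/\ forall e, kept s e ->
        phi (occ_map (@parent V) e) (+) phi (occ_map (@child V) e) = we e,
      forall c, phi (inr (cut_ends c).1) (+) phi (inr (cut_ends c).2) = wc c &
      forall n : neg (occ_leaves G),
        phi (occ_map (@leaf_vertex V) (sval n)) (+)
        phi (occ_map (@leaf_vertex V) (sval (f n))) = wl (sval n)].

Definition correct {V} {G : cut_sequent V} (f : leaf_fun G) : Prop :=
  forall s,
    (forall we wc wl, exists phi, coboundary f s we wc wl phi) /\
    (forall phi, coboundary f s xpred0 xpred0 xpred0 phi ->
       forall u v, phi u = phi v).

Lemma correctP V (G : cut_sequent V) (f : leaf_fun G) :
  (forall s, is_tree (switching_graph f s)) <-> correct f.
Proof.
have cob s we wc wl phi : coboundary f s we wc wl phi <->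
    forall e : gedge (switching_graph f s),
      phi (ends e).1 (+) phi (ends e).2 = match e with
        | inl (inl e) => we (sval e) | inl (inr c) => wc c
        | inr n => wl (sval n) end.
  split=> [[He Hc Hl] [[[e k]|c]|n] /=|H].
  - exact: He.
  - exact: Hc.
  - exact: Hl.
  split=> [e k|c|n].
  - exact: (H (inl (inl (exist _ e k)))).
  - exact: (H (inl (inr c))).
  - exact: (H (inr n)).
split=> H s.
  have [solv rig] := (is_treeP _).1 (H s); split.
    move=> we wc wl.
    have [phi phiE] := solv (fun e => match e with
        | inl (inl e) => we (sval e) | inl (inr c) => wc c
        | inr n => wl (sval n) end).
    by exists phi; apply/cob.
  by move=> phi /cob phi0; apply: rig => e; rewrite phi0; case: e => [[]|].
have [solv rig] := H s; apply/is_treeP; split.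
  move=> w.
  (* [coboundary] takes weights on all argument edges and leaves; the default [false] sits on
     deleted edges and positive leaves, where it is never read. *)
  pose we e := oapp (fun k => w (inl (inl k))) false (insub e).
  pose wl l := oapp (fun k => w (inr k)) false (insub l).
  have [phi /cob phiE] := solv we (fun c => w (inl (inr c))) wl.
  exists phi => e; rewrite phiE; case: e => [[e|//]|n].
    by rewrite /we valK.
  by rewrite /wl valK.
by move=> phi phi0; apply: rig; apply/cob => e; rewrite phi0; case: e => [[]|].
Qed.

Lemma matchingP V (G : cut_sequent V) (f : leaf_fun G) :
  matching f <-> forall P : V,
    [/\ forall n, occ_label (sval n) = Dual P -> occ_label (sval (f n)) = Var P,
        forall n n', occ_label (sval n) = Dual P ->
          occ_label (sval n') = Dual P -> f n = f n' -> n = n' &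
        forall p, occ_label (sval p) = Var P ->
          exists2 n, occ_label (sval n) = Dual P & f n = p].
Proof.
split=> H P.
  have [Hf Hi Hs] := H P; split=> [n nP|n n' nP n'P|p pP].
  - exact: Hf.
  - by apply: Hi; rewrite inE.
  - by have [n /= nP <-] := Hs p pP; exists n.
have [Hf Hi Hs] := H P; split=> [n nP|n n'|p pP].
- exact: Hf.
- by rewrite !inE => nP n'P; exact: Hi.
- by have [n /= nP <-] := Hs p pP; exists n.
Qed.

Definition proper {V} {G : cut_sequent V} (f : leaf_fun G) :=
  matching f /\ correct f.

Lemma is_proof_netP V (G : cut_sequent V) (f : leaf_fun G) :
  is_proof_net f <-> proper f.
Proof. by rewrite /is_proof_net /proper correctP. Qed.

Lemma sig_eq (T : Type) (P : pred T) (x y : {x | P x}) : sval x = sval y -> x = y.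
Proof.
by case: x y => [x px] [y py] /= e; subst y; rewrite (bool_irrelevance px py).
Qed.

(** * Eliminating a compound cut *)

(* If both switchings of the par vertex give a tree, then deleting the tensor
   and the par vertex of a cut leaves three components, those of the premises
   [b], [c] of the tensor and a common one for the premises [b'], [c'] of the
   par: hence joining [b] to [b'] and [c] to [c'] gives a tree again. *)
Lemma compound_cut_tree (E X : Type) (act : E -> bool) (src tgt : E -> X)
    (b c b' c' : X) :
  let cob w (phi : X -> bool) :=
    forall e, act e -> phi (src e) (+) phi (tgt e) = w e in
  let three d :=
    (forall w x y z, exists phi,
       [/\ cob w phi, phi b = x, phi c = y & phi d = z]) /\
    (forall phi, cob xpred0 phi ->
       phi b = false -> phi c = false -> phi d = false ->
       forall v, phi v = false) in
  three b' -> three c' ->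
  (forall w x y, exists phi,
     [/\ cob w phi, phi b (+) phi b' = x & phi c (+) phi c' = y]) /\
  (forall phi, cob xpred0 phi ->
     phi b (+) phi b' = false -> phi c (+) phi c' = false ->
     forall u v, phi u = phi v).
Proof.
move=> cob three [Lsol Luniq] [Rsol Runiq].
have same phi : cob xpred0 phi -> phi b' = phi c'.
  wlog: phi / phi b = false.
    move=> IH phi0; case pb: (phi b); last exact: IH.
    apply: negb_inj; apply: (IH (fun v => ~~ phi v)); first by rewrite pb.
    by move=> e /phi0; rewrite addNb addbN negbK.
  (* [psi] is flat, 0 at [b] and [c], 1 at [b'], hence also 1 at [c']. So the product [chi] agrees
     with [phi] at [b'] and [c'] and vanishes at [b] and [c]; if [phi] separated [b'] from [c'],
     [chi] would vanish at exactly one of them, against uniqueness. *)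
  move=> pb phi0; have [psi [psi0 psib psic psib']] := Lsol xpred0 false false true.
  have psic' : psi c' = true.
    case e: (psi c') => //.
    by have := Runiq _ psi0 psib psic e b'; rewrite psib'.
  pose chi v := phi v && psi v.
  have chi0 : cob xpred0 chi.
    move=> e ae; move: (phi0 e ae) (psi0 e ae); rewrite /chi.
    by case: (phi _); case: (phi _); case: (psi _); case: (psi _).
  have chib : chi b = false by rewrite /chi pb.
  have chic : chi c = false by rewrite /chi psic andbF.
  case pb': (phi b').
    case pc': (phi c') => //.
    have := Runiq _ chi0 chib chic _ b'.
    by rewrite {1 2}/chi pb' pc' psib' => /(_ erefl).
  case pc': (phi c') => //.
  have := Luniq _ chi0 chib chic _ c'.
  by rewrite {1 2}/chi pb' pc' psic' => /(_ erefl).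
split=> [w x y|phi phi0 pb pc u v].
  (* [th] realises the weights, and [ka] is a flat correction. Its value at [c] absorbs [th c'],
     which [Lsol] does not prescribe, while [same] transfers its value 0 from [b'] to [c']. *)
  have [th [thw thb thc thb']] := Lsol w false false false.
  have [ka [ka0 kab kac kab']] := Lsol xpred0 x (y (+) th c') false.
  have kac' : ka c' = false by rewrite -same.
  exists (fun v => th v (+) ka v); split.
  - by move=> e ae; rewrite addbACA thw // ka0 // addbF.
  - by rewrite thb kab thb' kab' /= addbF.
  - by rewrite thc kac kac' /= addbF -addbA addbb addbF.
have phib v' : phi v' (+) phi b = false.
  apply: (Luniq (fun v => phi v (+) phi b)).
  - by move=> e ae; rewrite addbACA phi0 // addbb.
  - by rewrite addbb.
  - move: pb pc; rewrite (same _ phi0).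
    by case: (phi b); case: (phi c); case: (phi c').
  - by rewrite addbC.
by move: (phib u) (phib v); case: (phi u); case: (phi v); case: (phi b).
Qed.

(* The occurrences in a sequent with a cut on a compound formula are those in the
   sequent after the elimination step, reassociated, together with the roots
   [None] of the two cut formulas and their argument edges. *)
Definition lift_compound {S B B' C C' R X : Type}
    (phi : S + ((B + B') + ((C + C') + R)) -> X) (x y : X)
    (v : S + ((option (B + C) + option (B' + C')) + R)) : X :=
  match v with
  | inl a => phi (inl a)
  | inr (inl (inl None)) => x
  | inr (inl (inl (Some (inl b)))) => phi (inr (inl (inl b)))
  | inr (inl (inl (Some (inr c)))) => phi (inr (inr (inl (inl c))))
  | inr (inl (inr None)) => y
  | inr (inl (inr (Some (inl b)))) => phi (inr (inl (inr b)))
  | inr (inl (inr (Some (inr c)))) => phi (inr (inr (inl (inr c))))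
  | inr (inr r) => phi (inr (inr (inr r)))
  end.

Definition compound_vertex {S B B' C C' R : Type}
    (v : S + ((B + B') + ((C + C') + R))) :
    S + ((option (B + C) + option (B' + C')) + R) :=
  match v with
  | inl a => inl a
  | inr (inl (inl b)) => inr (inl (inl (Some (inl b))))
  | inr (inl (inr b)) => inr (inl (inr (Some (inl b))))
  | inr (inr (inl (inl c))) => inr (inl (inl (Some (inr c))))
  | inr (inr (inl (inr c))) => inr (inl (inr (Some (inr c))))
  | inr (inr (inr r)) => inr (inr r)
  end.

Definition lift_compound_edge {S B B' C C' R X : Type}
    (w : S + ((B + B') + ((C + C') + R)) -> X) (x y : bool -> X)
    (e : S + (((bool + (B + C)) + (bool + (B' + C'))) + R)) : X :=
  match e with
  | inl a => w (inl a)
  | inr (inl (inl (inl i))) => x i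
  | inr (inl (inl (inr (inl b)))) => w (inr (inl (inl b)))
  | inr (inl (inl (inr (inr c)))) => w (inr (inr (inl (inl c))))
  | inr (inl (inr (inl i))) => y i
  | inr (inl (inr (inr (inl b)))) => w (inr (inl (inr b)))
  | inr (inl (inr (inr (inr c)))) => w (inr (inr (inl (inr c))))
  | inr (inr r) => w (inr (inr (inr r)))
  end.

Definition join_compound_leaf {S B B' C C' R : Type}
    (x : S + ((B + C) + (B' + C') + R)) : S + ((B + B') + ((C + C') + R)) :=
  match x with
  | inl a => inl a
  | inr (inl (inl (inl b))) => inr (inl (inl b))
  | inr (inl (inl (inr c))) => inr (inr (inl (inl c)))
  | inr (inl (inr (inl b))) => inr (inl (inr b))
  | inr (inl (inr (inr c))) => inr (inr (inl (inr c)))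
  | inr (inr r) => inr (inr (inr r))
  end.

(** A cut pair is unordered, but its listed formula may be the tensor or the par; the flag treats
    both steps uniformly. *)
Definition compound {V} (o : bool) (B C : formula V) :=
  if o then Tensor B C else Par B C.

Definition compound_step {V} o (B C : formula V) D :
    cut_step (compound o B C :: D) [:: B, C & D] :=
  match o with true => TensorCut B C D | false => ParCut B C D end.

Lemma compound_residual_surj V (G : sequent V) o B C D
    (l : occ_leaves (CutSequent G (compound o B C :: D))) :
  exists l', residual (compound_step o B C D) l' = l.
Proof.
by case: o l => l; exists (join_compound_leaf l);
   case: l => [a|[[[b|c]|[b|c]]|r]].
Qed.

Lemma compound_residual_inj V (G : sequent V) o B C D :
  injective (@residual V G _ _ (compound_step o B C D)).
Proof.
case: o; apply: (can_inj (g := @join_compound_leaf _ _ _ _ _ _));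
  by case=> [a|[[b|b]|[[c|c]|r]]].
Qed.

Lemma compound_deleted V (G : sequent V) o B C D
    (l : occ_leaves (CutSequent G (compound o B C :: D))) :
  deleted (compound_step o B C D) l = false.
Proof. by case: o l => [] [a|l]. Qed.

Lemma compound_matching V (G : sequent V) o B C D
    (f : leaf_fun (CutSequent G (compound o B C :: D)))
    (f' : leaf_fun (CutSequent G [:: B, C & D])) :
  (forall n, pos_map (@residual_sign V G _ _ (compound_step o B C D)) (f' n) =
     f (neg_map (@residual_sign V G _ _ (compound_step o B C D)) n)) ->
  matching f -> matching f'.
Proof.
set r := compound_step o B C D => ff' /matchingP H; apply/matchingP => P.
have [Hf Hi Hs] := H P.
have lf n : occ_label (sval (f' n)) =
    occ_label (sval (f (neg_map (@residual_sign V G _ _ r) n))).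
  by rewrite -ff' /= residual_label.
split=> [n nP|n n' nP n'P e|p pP].
- by rewrite lf; apply: Hf; rewrite /= residual_label.
- have /(congr1 sval)/= : neg_map (@residual_sign V G _ _ r) n =
      neg_map (@residual_sign V G _ _ r) n'.
    by apply: Hi; rewrite /= ?residual_label // -!ff' e.
  by move/compound_residual_inj/sig_eq.
- have [|[l ln] lP le] := Hs (pos_map (@residual_sign V G _ _ r) p).
    by rewrite /= residual_label.
  have [l' el] := compound_residual_surj l.
  have l'n : ~~ @positive (occ_leaves (CutSequent G [:: B, C & D])) l'.
    by rewrite -(residual_sign (compound_step o B C D)) el.
  exists (exist _ l' l'n); first by rewrite -lP /= -el residual_label.
  apply: sig_eq; apply: (@compound_residual_inj V G o B C D).
  have := ff' (exist _ l' l'n); move/(congr1 sval) => /= ->.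
  have -> : neg_map (@residual_sign V G _ _ r) (exist _ l' l'n) = exist _ l ln.
    exact: sig_eq.
  by rewrite le.
Qed.

(** Apart from the two new cuts, the graph after the step is the graph before it without the tensor
    and par roots. Each side [d] of the par gives a switching before the step and thereby one
    hypothesis of [compound_cut_tree]; its conclusion adds the two new cuts. *)
Lemma compound_correct V (G : sequent V) o B C D
    (f : leaf_fun (CutSequent G (compound o B C :: D)))
    (f' : leaf_fun (CutSequent G [:: B, C & D])) :
  (forall n, pos_map (@residual_sign V G _ _ (compound_step o B C D)) (f' n) =
     f (neg_map (@residual_sign V G _ _ (compound_step o B C D)) n)) ->
  correct f -> correct f'.
Proof.
move=> ff' corr s'.
pose K := CutSequent G [:: B, C & D].
pose E : Type := ((occ_sum edge K + cut_edge D) + neg (occ_leaves K))%type.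
pose act (e : E) := if e is inl (inl e) then kept s' e else true.
pose src (e : E) : occ_sum vertex K := match e with
  | inl (inl e) => occ_map (@parent V) e
  | inl (inr c) => inr (inr (inr (cut_ends c).1))
  | inr n => occ_map (@leaf_vertex V) (sval n) end.
pose tgt (e : E) : occ_sum vertex K := match e with
  | inl (inl e) => occ_map (@child V) e
  | inl (inr c) => inr (inr (inr (cut_ends c).2))
  | inr n => occ_map (@leaf_vertex V) (sval (f' n)) end.
pose rB : occ_sum vertex K := inr (inl (inl (root B))).
pose rB' : occ_sum vertex K := inr (inl (inr (root (dual B)))).
pose rC : occ_sum vertex K := inr (inr (inl (inl (root C)))).
pose rC' : occ_sum vertex K := inr (inr (inl (inr (root (dual C))))).
pose cob w (phi : occ_sum vertex K -> bool) :=
  forall e, act e -> phi (src e) (+) phi (tgt e) = w e.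
suff [solv rig] :
    (forall w x y, exists phi, [/\ cob w phi, phi rB (+) phi rB' = x &
        phi rC (+) phi rC' = y]) /\
    (forall phi, cob xpred0 phi -> phi rB (+) phi rB' = false ->
       phi rC (+) phi rC' = false -> forall u v, phi u = phi v).
  split=> [we wc wl|phi [phie phic phil]].
    have [phi [phiw phiB phiC]] := solv (fun e => match e with
      | inl (inl e) => we e | inl (inr c) => wc (Some (Some c))
      | inr n => wl (sval n) end) (wc None) (wc (Some None)).
    exists phi; split=> [e k|[[c|]|]|n] //.
    - exact: (phiw (inl (inl e)) k).
    - exact: (phiw (inl (inr c)) isT).
    - exact: (phiw (inr n) isT).
  apply: rig; last exact: (phic (Some None)); last exact: (phic None).
  move=> [[e|c]|n] k; first exact: phie.
    exact: (phic (Some (Some c))).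
  exact: phil.
(* [hB], [hC] are the premises of the tensor and [hB'], [hC'] those of the par, whichever of the two
   formulas is listed. *)
pose hB := if o then rB else rB'; pose hB' := if o then rB' else rB.
pose hC := if o then rC else rC'; pose hC' := if o then rC' else rC.
have three d : 
    (forall w x y z, exists phi,
       [/\ cob w phi, phi hB = x, phi hC = y & phi (if d then hC' else hB') = z]) /\
    (forall phi, cob xpred0 phi ->
       phi hB = false -> phi hC = false -> phi (if d then hC' else hB') = false ->
       forall v, phi v = false).
  rewrite {}/hB {}/hB' {}/hC {}/hC'.
  case: o f ff' corr => f ff' corr.
  - have {corr} [solv rig] := corr (lift_compound s' d d).
    pose st := compound_step true B C D.
    have lv (l : occ_leaves K) : occ_map (@leaf_vertex V) (residual st l) =
        compound_vertex (occ_map (@leaf_vertex V) l).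
      by case: l => [a|[[b|b]|[[c|c]|r]]].
    split=> [w x y z|phi phi0 pB pC pd].
      pose wl l := oapp (fun n => w (inr n)) false (insub (join_compound_leaf l)).
      (* Colours are read relative to the tensor root, whose argument edges prescribe [x] and [y].
         The old cut has weight 0, so the par root has the colour of the tensor root and its kept
         edge prescribes [z]. *)
      have {solv} [phi [phie phic phil]] := solv
        (lift_compound_edge (fun e => w (inl (inl e)))
           (fun i => if i then y else x) (fun _ => z))
        (fun c => if c is Some c then w (inl (inr c)) else false) wl.
      exists (fun v => phi (compound_vertex v) (+) phi (inr (inl (inl None)))).
      split.
      + move=> e ae; rewrite addbACA addbb addbF.
        case: e ae => [[[a|[[b|b]|[[c|c]|r]]]|c]|n] /= ae.
        * exact: (phie (inl a) ae).
        * exact: (phie (inr (inl (inl (inr (inl b))))) ae).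
        * exact: (phie (inr (inl (inr (inr (inl b))))) ae).
        * exact: (phie (inr (inl (inl (inr (inr c))))) ae).
        * exact: (phie (inr (inl (inr (inr (inr c))))) ae).
        * exact: (phie (inr (inr r)) ae).
        * exact: (phic (Some c)).
        * have := phil (neg_map (@residual_sign V G _ _ st) n).
          rewrite -ff' /= !lv => ->; rewrite /wl.
          have -> : join_compound_leaf (residual st (sval n)) = sval n.
            by case: (sval n) => [a|[[b|b]|[[c|c]|r]]].
          by rewrite (valK n).
      + by rewrite addbC; exact: (phie (inr (inl (inl (inl false)))) isT).
      + by rewrite addbC; exact: (phie (inr (inl (inl (inl true)))) isT).
      + have /= := phie (inr (inl (inr (inl d)))); rewrite /kept /= eqxx => /(_ isT) <-.
        have /= := phic None.
        by case: (d); case: (phi (inr (inl (inl None))));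
          case: (phi (inr (inl (inr None)))); rewrite /= ?addbF ?addbT.
    (* With 0 at both deleted roots, a flat colouring vanishing at the three premises extends to a
       flat one; this is constant, equal to its value 0 at a root. *)
    move=> v; have := rig (lift_compound phi false false).
    move=> /(_ _ (compound_vertex v) (inr (inl (inl None)))) /=.
    have -> : lift_compound phi false false (compound_vertex v) = phi v.
      by case: v => [a|[[b|b]|[[c|c]|r]]].
    apply; split.
    + case=> [a|[[[i|[b|c]]|[i|[b|c]]]|r]] ae.
      * exact: (phi0 (inl (inl (inl a))) ae).
      * by case: i {ae}; [exact: pC | exact: pB].
      * exact: (phi0 (inl (inl (inr (inl (inl b))))) ae).
      * exact: (phi0 (inl (inl (inr (inr (inl (inl c)))))) ae).
      * move: ae; rewrite /kept /= => /eqP ->; by case: (d) pd.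
      * exact: (phi0 (inl (inl (inr (inl (inr b))))) ae).
      * exact: (phi0 (inl (inl (inr (inr (inl (inr c)))))) ae).
      * exact: (phi0 (inl (inl (inr (inr (inr r))))) ae).
    + case=> [c|//]; exact: (phi0 (inl (inr c)) isT).
    + move=> n; have [l' l'n] := @compound_residual_surj V G true B C D (sval n).
      have l'neg : ~~ @positive (occ_leaves K) l'.
        by rewrite -(residual_sign st) l'n (svalP n).
      have -> : n = neg_map (@residual_sign V G _ _ st) (exist _ l' l'neg).
        exact: sig_eq.
      rewrite -ff' /= !lv.
      have liftK v' : lift_compound phi false false (compound_vertex v') = phi v'.
        by case: v' => [a|[[b|b]|[[c|c]|r]]].
      by rewrite !liftK; exact: (phi0 (inr (exist _ l' l'neg)) isT).
  (* The same argument with the par listed: the tensor root is now that of the dual formula. *)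
  - have {corr} [solv rig] := corr (lift_compound s' d d).
    pose st := compound_step false B C D.
    have lv (l : occ_leaves K) : occ_map (@leaf_vertex V) (residual st l) =
        compound_vertex (occ_map (@leaf_vertex V) l).
      by case: l => [a|[[b|b]|[[c|c]|r]]].
    split=> [w x y z|phi phi0 pB pC pd].
      pose wl l := oapp (fun n => w (inr n)) false (insub (join_compound_leaf l)).
      have {solv} [phi [phie phic phil]] := solv
        (lift_compound_edge (fun e => w (inl (inl e)))
           (fun _ => z) (fun i => if i then y else x))
        (fun c => if c is Some c then w (inl (inr c)) else false) wl.
      exists (fun v => phi (compound_vertex v) (+) phi (inr (inl (inr None)))).
      split.
      + move=> e ae; rewrite addbACA addbb addbF.
        case: e ae => [[[a|[[b|b]|[[c|c]|r]]]|c]|n] /= ae.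
        * exact: (phie (inl a) ae).
        * exact: (phie (inr (inl (inl (inr (inl b))))) ae).
        * exact: (phie (inr (inl (inr (inr (inl b))))) ae).
        * exact: (phie (inr (inl (inl (inr (inr c))))) ae).
        * exact: (phie (inr (inl (inr (inr (inr c))))) ae).
        * exact: (phie (inr (inr r)) ae).
        * exact: (phic (Some c)).
        * have := phil (neg_map (@residual_sign V G _ _ st) n).
          rewrite -ff' /= !lv => ->; rewrite /wl.
          have -> : join_compound_leaf (residual st (sval n)) = sval n.
            by case: (sval n) => [a|[[b|b]|[[c|c]|r]]].
          by rewrite (valK n).
      + by rewrite addbC; exact: (phie (inr (inl (inr (inl false)))) isT).
      + by rewrite addbC; exact: (phie (inr (inl (inr (inl true)))) isT).
      + have /= := phie (inr (inl (inl (inl d)))); rewrite /kept /= eqxx => /(_ isT) <-.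
        have /= := phic None.
        by case: (d); case: (phi (inr (inl (inl None))));
          case: (phi (inr (inl (inr None)))); rewrite /= ?addbF ?addbT.
    move=> v; have := rig (lift_compound phi false false).
    move=> /(_ _ (compound_vertex v) (inr (inl (inl None)))) /=.
    have -> : lift_compound phi false false (compound_vertex v) = phi v.
      by case: v => [a|[[b|b]|[[c|c]|r]]].
    apply; split.
    + case=> [a|[[[i|[b|c]]|[i|[b|c]]]|r]] ae.
      * exact: (phi0 (inl (inl (inl a))) ae).
      * move: ae; rewrite /kept /= => /eqP ->; by case: (d) pd.
      * exact: (phi0 (inl (inl (inr (inl (inl b))))) ae).
      * exact: (phi0 (inl (inl (inr (inr (inl (inl c)))))) ae).
      * by case: i {ae}; [exact: pC | exact: pB].
      * exact: (phi0 (inl (inl (inr (inl (inr b))))) ae).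
      * exact: (phi0 (inl (inl (inr (inr (inl (inr c)))))) ae).
      * exact: (phi0 (inl (inl (inr (inr (inr r))))) ae).
    + case=> [c|//]; exact: (phi0 (inl (inr c)) isT).
    + move=> n; have [l' l'n] := @compound_residual_surj V G false B C D (sval n).
      have l'neg : ~~ @positive (occ_leaves K) l'.
        by rewrite -(residual_sign st) l'n (svalP n).
      have -> : n = neg_map (@residual_sign V G _ _ st) (exist _ l' l'neg).
        exact: sig_eq.
      rewrite -ff' /= !lv.
      have liftK v' : lift_compound phi false false (compound_vertex v') = phi v'.
        by case: v' => [a|[[b|b]|[[c|c]|r]]].
      by rewrite !liftK; exact: (phi0 (inr (exist _ l' l'neg)) isT).
(* The two choices of [d] are the two switchings of the par. When the par is listed, the ends of the
   new cuts come out exchanged. *)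
move: (compound_cut_tree (three false) (three true)).
rewrite /hB /hB' /hC /hC'; case: (o) => // -[solv rig]; split=> [w x y|phi phi0 pB pC].
  have [phi [phiw <- <-]] := solv w x y; exists phi; split => //; exact: addbC.
by apply: rig => //; rewrite addbC.
Qed.

(** * Eliminating an atomic cut *)

Lemma positive_dual_atom V (a : atom V) :
  positive_atom (dual_atom a) = ~~ positive_atom a.
Proof. by case: a. Qed.

Lemma dual_atomK V : involutive (@dual_atom V).
Proof. by case. Qed.

(** This settles the choice of sign once: [p] is the positive leaf of the cut pair and [m] the
    negative one. The last clause lets the cut be treated as an edge between [p] and [m] without a
    case split on [a]. *)
Lemma atom_cut_leaves V (G : sequent V) a D
    (K := CutSequent G (Atom a :: D)) :
  exists (p : pos (occ_leaves K)) (m : neg (occ_leaves K)),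
    [/\ forall q : pos (occ_leaves K),
          deleted (AtomCut a D) (sval q) = (sval q == sval p),
        forall n : neg (occ_leaves K),
          deleted (AtomCut a D) (sval n) = (sval n == sval m),
        occ_label (sval p) = dual_atom (occ_label (sval m)) &
        forall phi : occ_sum vertex K -> bool,
          phi (occ_map (@leaf_vertex V) (sval p)) (+)
          phi (occ_map (@leaf_vertex V) (sval m)) =
          phi (inr (inl (inl tt))) (+) phi (inr (inl (inr tt)))].
Proof.
pose l1 : occ_leaves K := inr (inl (inl tt)).
pose l2 : occ_leaves K := inr (inl (inr tt)).
case pa: (positive_atom a).
  have p1 : positive l1 by [].
  have n2 : ~~ positive l2 by rewrite /= positive_dual_atom pa.
  exists (exist _ l1 p1), (exist _ l2 n2); split => //=.
  - case=> [[g|[[[]|[]]|d]] //= q]; symmetry; apply/eqP => //.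
    by move: q; rewrite positive_dual_atom pa.
  - by case=> [[g|[[[]|[]]|d]] //= q]; move: q; rewrite pa.
  - by rewrite dual_atomK.
have p2 : positive l2 by rewrite /= positive_dual_atom pa.
have n1 : ~~ positive l1 by rewrite /= pa.
exists (exist _ l2 p2), (exist _ l1 n1); split => //=.
- by case=> [[g|[[[]|[]]|d]] //= q]; move: q; rewrite pa.
- case=> [[g|[[[]|[]]|d]] //= q]; symmetry; apply/eqP => //.
  by move: q; rewrite positive_dual_atom pa.
- by move=> phi; rewrite addbC.
Qed.

Lemma atom_residual V (G : sequent V) a D
    (l : occ_leaves (CutSequent G (Atom a :: D))) :
  ~~ deleted (AtomCut a D) l -> exists l', residual (AtomCut a D) l' = l.
Proof. by case: l => [g|[[[]|[]]|d]] // _; [exists (inl g) | exists (inr d)]. Qed.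

Lemma atom_residual_pos V (G : sequent V) a D
    (p : pos (occ_leaves (CutSequent G (Atom a :: D)))) :
  ~~ deleted (AtomCut a D) (sval p) ->
  exists p', pos_map (@residual_sign V G _ _ (AtomCut a D)) p' = p.
Proof.
move=> /atom_residual[l' l'p].
have pl : positive (l' : occ_leaves (CutSequent G D)).
  by rewrite -(residual_sign (AtomCut a D)) l'p (svalP p).
by exists (exist _ l' pl); exact: sig_eq.
Qed.

Lemma atom_residual_neg V (G : sequent V) a D
    (p : neg (occ_leaves (CutSequent G (Atom a :: D)))) :
  ~~ deleted (AtomCut a D) (sval p) ->
  exists p', neg_map (@residual_sign V G _ _ (AtomCut a D)) p' = p.
Proof.
move=> /atom_residual[l' l'p].
have pl : ~~ positive (l' : occ_leaves (CutSequent G D)).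
  by rewrite -(residual_sign (AtomCut a D)) l'p (svalP p).
by exists (exist _ l' pl); exact: sig_eq.
Qed.

Lemma atom_not_deleted V (G : sequent V) a D (l : occ_leaves (CutSequent G D)) :
  deleted (AtomCut a D) (residual (AtomCut a D) l) = false.
Proof. by case: l. Qed.

Lemma atom_residual_inj V (G : sequent V) a D :
  injective (@residual V G _ _ (AtomCut a D)).
Proof. by move=> [x|x] [y|y] // [->]. Qed.

(* The cut and the edge leaving the negative leaf of the cut pair would be
   parallel. *)
Lemma atom_cut_no_loop V (G : sequent V) a D
    (f : leaf_fun (CutSequent G (Atom a :: D))) m :
  correct f -> deleted (AtomCut a D) (sval m) ->
  deleted (AtomCut a D) (sval (f m)) = false.
Proof.
move=> corr; have [p [m' [pE mE _ cutE]]] := atom_cut_leaves G a D.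
rewrite mE => /eqP/sig_eq ?; subst m'; rewrite pE.
apply/eqP => fm.
have [solv _] := corr xpred0.
(* Weight 1 on the cut and 0 on the parallel edge would make the same two leaves both differ and
   agree. *)
have [phi [_ phic phil]] := solv xpred0 (fun c => c == None) xpred0.
have /= := phic None; rewrite eqxx -cutE -fm.
by have := phil m; rewrite addbC => ->.
Qed.

(** The cut and the edge leaving [m] form a path from [p] through [m] to [f m]; redirecting the
    edges into [p] towards [f m] contracts this path. *)
Lemma atom_proper V (G : sequent V) a D
    (f : leaf_fun (CutSequent G (Atom a :: D))) (f' : leaf_fun (CutSequent G D)) :
  proper f -> eliminates (AtomCut a D) f f' -> proper f'.
Proof.
move=> [match_f corr]; have [p [m [pE mE lpm cutE]]] := atom_cut_leaves G a D.
rewrite /eliminates; set nmap := neg_map _; set pmap := pos_map _ => elim.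
have md : deleted (AtomCut a D) (sval m) by rewrite mE.
have {}elim n : pmap (f' n) = if f (nmap n) == p then f m else f (nmap n).
  have /= := elim n; rewrite pE -(inj_eq val_inj).
  by case: ifP => // _ [m']; rewrite mE => /eqP/sig_eq ->.
have lab n : occ_label (sval (f' n)) = occ_label (sval (pmap (f' n))).
  by rewrite /= residual_label.
have labn n : occ_label (sval (nmap n)) = occ_label (sval n).
  by rewrite /= residual_label.
have fm : f m != p.
  rewrite -(inj_eq val_inj); have := atom_cut_no_loop corr md.
  by rewrite pE => /negbT.
have nm n : nmap n <> m.
  by move=> e; move: md; rewrite -e atom_not_deleted.
split.
  move/matchingP: match_f => match_f; apply/matchingP => P.
  have [Hf Hi Hs] := match_f P.
  have dualm : occ_label (sval p) = Var P -> occ_label (sval m) = Dual P.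
    by rewrite lpm; case: (occ_label _) => //= Q [->].
  split=> [n nP|n n' nP n'P e|q qP].
  - rewrite lab elim; have fnP := Hf (nmap n); rewrite labn in fnP.
    case: eqP => [fn|_]; last exact: fnP.
    by apply/Hf/dualm; rewrite -fn; exact: fnP.
  - have : nmap n = nmap n'.
      (* If exactly one of the two edges was reset, injectivity of [f] would identify the source of
         the other with [m], which is not a residual. *)
      have := congr1 pmap e; rewrite !elim.
      have fnP := Hf (nmap n); rewrite labn in fnP.
      have fn'P := Hf (nmap n'); rewrite labn in fn'P.
      case: eqP => [fn|_]; case: eqP => [fn'|_] ee.
      + by apply: Hi; rewrite ?labn // fn fn'.
      + case: (nm n'); apply: Hi; rewrite ?labn //.
        by apply: dualm; rewrite -fn; exact: fnP.
      + case: (nm n); apply: Hi; rewrite ?labn //.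
        by apply: dualm; rewrite -fn'; exact: fn'P.
      + by apply: Hi; rewrite ?labn.
    by move/(congr1 sval)/atom_residual_inj/sig_eq.
  - have [|n nP fn] := Hs (pmap q); first by rewrite /= residual_label.
    case: (eqVneq n m) => [?|nm']; last first.
      have [|n' n'E] := @atom_residual_neg V G a D n.
        by rewrite mE (inj_eq val_inj).
      exists n'; first by rewrite -labn [nmap n']n'E.
      have := elim n'; rewrite [nmap n']n'E fn ifF.
        by move/(congr1 sval)/atom_residual_inj/sig_eq.
      apply/eqP => /(congr1 sval) e; have := pE p; rewrite eqxx -e.
      by rewrite atom_not_deleted.
    (* A leaf that was the target of [m] is now reached from the old source of [p]; that source
       survives because [f m] is not [p]. *)
    subst n; have [|n' n'P fn'] := Hs p; first by rewrite lpm nP.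
    have [|n n'E] := @atom_residual_neg V G a D n'.
      rewrite mE (inj_eq val_inj); apply/eqP => e.
      by move: fm; rewrite -fn' e eqxx.
    exists n; first by rewrite -labn [nmap n]n'E.
    have := elim n; rewrite [nmap n]n'E fn' eqxx fn.
    by move/(congr1 sval)/atom_residual_inj/sig_eq.
move=> s'; pose X : finType := occ_sum vertex (CutSequent G (Atom a :: D)).
pose lift Y (phi : occ_sum vertex (CutSequent G D) -> Y) (y : Y) (v : X) :=
  match v with inl v => phi (inl v) | inr (inl _) => y | inr (inr v) => phi (inr v) end.
pose emb (v : occ_sum vertex (CutSequent G D)) : X :=
  match v with inl v => inl v | inr v => inr (inr v) end.
have lv (l : occ_leaves (CutSequent G D)) :
    occ_map (@leaf_vertex V) (residual (AtomCut a D) l) =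
      emb (occ_map (@leaf_vertex V) l).
  by case: l.
have [solv rig] := corr (lift _ s' false); split.
  move=> we wc wl.
  have [phi [phie phic phil]] := solv
    (fun e => match e with
       | inl e => we (inl e)
       | inr (inl _) => false
       | inr (inr e) => we (inr e) end)
    (fun c => if c is Some c then wc c else false)
    (fun l => match l with
       | inl l => wl (inl l)
       | inr (inl _) => false
       | inr (inr l) => wl (inr l) end).
  (* Weight 0 on the cut and on the edge leaving [m] forces [p], [m] and [f m] to share a colour, so
     a reset edge keeps its coboundary. *)
  have phim : phi (occ_map (@leaf_vertex V) (sval p)) =
      phi (occ_map (@leaf_vertex V) (sval (f m))).
    have := phil m; have := phic None; rewrite /= -cutE.
    have : deleted (AtomCut a D) (sval m) by rewrite mE.
    case: (sval m) => [//|[[[]|[]]|//]] _;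
    by case: (phi _); case: (phi _); case: (phi _).
  exists (phi \o emb); split=> [e k|c|n].
  - by case: e k => e k; [exact: (phie (inl e) k) | exact: (phie (inr (inr e)) k)].
  - exact: (phic (Some c)).
  - rewrite /= -!lv -[residual _ (sval (f' n))]/(sval (pmap (f' n))) elim.
    have := phil (nmap n).
    case: eqP => [->|_]; rewrite ?phim /= => ->; by case: (sval n).
move=> phi [phie phic phil] u v.
have [fm' fm'E] := @atom_residual_pos V G a D (f m) (negbT (atom_cut_no_loop corr md)).
(* Both deleted leaves receive the colour of [f m], as flatness on the contracted path demands. *)
pose y := phi (occ_map (@leaf_vertex V) (sval fm')).
have liftE w : lift _ phi y (emb w) = phi w by case: w.
rewrite -!liftE; apply: rig; split.
- case=> [e|[[[]|[]]|e]] k; first exact: (phie (inl e) k).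
  exact: (phie (inr e) k).
- by case=> [c|]; [exact: phic | rewrite /= addbb].
move=> n.
have liftd l : deleted (AtomCut a D) l -> lift _ phi y (occ_map (@leaf_vertex V) l) = y.
  by case: l => [//|[[[]|[]]|//]].
case: (eqVneq n m) => [->|nm'].
  rewrite liftd // -fm'E /= lv liftE; exact: addbb.
have [|n' n'E] := @atom_residual_neg V G a D n.
  by rewrite mE (inj_eq val_inj).
rewrite -{1}n'E /= lv liftE; have := elim n'; rewrite [nmap n']n'E.
case: eqP => [fn|_].
  rewrite fn liftd ?pE // => e.
  have -> : y = phi (occ_map (@leaf_vertex V) (sval (f' n'))).
    congr (phi (occ_map _ _)); apply: (@atom_residual_inj V G a D).
    by rewrite -[LHS]/(sval (pmap fm')) -[RHS]/(sval (pmap (f' n'))) e -fm'E.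
  exact: phil.
by move=> <-; rewrite /= lv liftE; exact: phil.
Qed.

(** * Existence of normal forms *)

(** [eliminates] constrains residual images only, so the new target must be lifted along [residual].
    The second hypothesis ensures that a reset edge does not land on a deleted leaf again. *)
Lemma eliminates_exists V (G : sequent V) D D' (s : cut_step D D')
    (f : leaf_fun (CutSequent G D)) :
  (forall l : occ_leaves (CutSequent G D), ~~ deleted s l ->
     exists l', @residual V G D D' s l' = l) ->
  (forall n : neg (occ_leaves (CutSequent G D')),
     deleted s (sval (f (neg_map (@residual_sign V G D D' s) n))) ->
     exists2 m : neg (occ_leaves (CutSequent G D)),
       deleted s (sval m) & ~~ deleted s (sval (f m))) ->
  exists f' : leaf_fun (CutSequent G D'), eliminates s f f'.
Proof.
move=> surj reset.
have lift (q : pos (occ_leaves (CutSequent G D))) : ~~ deleted s (sval q) ->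
    exists q', pos_map (@residual_sign V G D D' s) q' = q.
  move=> /surj[l' l'q].
  have pl : positive (l' : occ_leaves (CutSequent G D')).
    by rewrite -(residual_sign s) l'q (svalP q).
  by exists (exist _ l' pl); exact: sig_eq.
suff /choice[f' f'E] : forall n : neg (occ_leaves (CutSequent G D')),
    exists p' : pos (occ_leaves (CutSequent G D')),
    let p := f (neg_map (@residual_sign V G D D' s) n) in
    let p' := pos_map (@residual_sign V G D D' s) p' in
    if deleted s (sval p)
    then exists2 m : neg (occ_leaves (CutSequent G D)),
           deleted s (sval m) & p' = f m
    else p' = p by exists f'.
move=> n; case dn: (deleted s (sval (f (neg_map (@residual_sign V G D D' s) n)))).
  have [m dm /lift[p' p'E]] := reset n dn.
  by exists p'; rewrite /= dn; exists m.
by have [p' p'E] := lift _ (negbT dn); exists p'; rewrite /= dn.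
Qed.

(** Atoms count 1 and connectives add 1, so that both atomic and compound steps strictly decrease
    the total over the cuts. *)
Fixpoint formula_size {V} (A : formula V) : nat :=
  match A with
  | Atom _ => 1
  | Tensor B C | Par B C => (formula_size B + formula_size C).+1
  end.

Lemma proper_step V (G : sequent V) A D (f : leaf_fun (CutSequent G (A :: D))) :
  proper f ->
  exists2 y : net G,
    elim_step (existT (fun D => leaf_fun (CutSequent G D)) (A :: D) f) y &
    proper (projT2 y) /\
    (sumn (map (@formula_size V) (projT1 y)) < sumn (map (@formula_size V) (A :: D)))%N.
Proof.
have compound_case o B C (g : leaf_fun (CutSequent G (compound o B C :: D))) : proper g ->
    exists2 y : net G,
      elim_step (existT (fun D => leaf_fun (CutSequent G D)) (compound o B C :: D) g) y &
      proper (projT2 y) /\ projT1 y = [:: B, C & D].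
  move=> [match_g corr_g].
  have [|n|g' g'E] := eliminates_exists (s := compound_step o B C D) (f := g).
  - by move=> l _; exact: compound_residual_surj.
  - by rewrite compound_deleted.
  exists (existT (fun D => leaf_fun (CutSequent G D)) [:: B, C & D] g').
    by exists (compound_step o B C D).
  have gg' n : pos_map (@residual_sign V G _ _ (compound_step o B C D)) (g' n) =
      g (neg_map (@residual_sign V G _ _ (compound_step o B C D)) n).
    by have := g'E n; rewrite /= compound_deleted.
  split=> //; split; first exact: compound_matching gg' match_g.
  exact: compound_correct gg' corr_g.
case: A f => [a|B C|B C] f proper_f.
- have [p [m [pE mE _ _]]] := atom_cut_leaves G a D.
  have [l|n|f' f'E] := eliminates_exists (s := AtomCut a D) (f := f).
  + exact: atom_residual.
  + have md : deleted (AtomCut a D) (sval m) by rewrite mE.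
    by exists m; rewrite ?(atom_cut_no_loop (proj2 proper_f)).
  exists (existT (fun D => leaf_fun (CutSequent G D)) D f').
    by exists (AtomCut a D).
  by split; [exact: atom_proper proper_f f'E | rewrite /= add1n].
- have [y step [py yE]] := compound_case true B C f proper_f.
  by exists y => //; split=> //; rewrite yE /= addSn addnA.
- have [y step [py yE]] := compound_case false B C f proper_f.
  by exists y => //; split=> //; rewrite yE /= addSn addnA.
Qed.

Lemma normal_form_exists V (G : sequent V) (x : net G) :
  proper (projT2 x) ->
  exists2 h : leaf_fun (CutSequent G [::]), proper h & is_normal_form x h.
Proof.
have [k] := ubnP (sumn (map (@formula_size V) (projT1 x))).
elim: k x => // k IH [[|A D] f] lt_k proper_f.
  by exists f => //; exact: rt_refl.
have [y step [proper_y lt_y]] := proper_step proper_f.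
have [|h proper_h nf] := IH y _ proper_y; first exact: leq_trans lt_y _.
by exists h => //; apply: rt_trans nf; exact: rt_step.
Qed.

(** * Cutting two proof nets against each other *)

Lemma union_net_left V (A B C : formula V)
    (f : leaf_fun (hom_cut_sequent A B)) (g : leaf_fun (hom_cut_sequent B C)) n :
  union_net f g (neg_map (@comp_left_sign V A B C) n) =
  pos_map (@comp_left_sign V A B C) (f n).
Proof.
by case: n => [[[l|l]|[]] ln]; rewrite /=; congr (pos_map _ (f _)); exact: sig_eq.
Qed.

Lemma union_net_right V (A B C : formula V)
    (f : leaf_fun (hom_cut_sequent A B)) (g : leaf_fun (hom_cut_sequent B C)) n :
  union_net f g (neg_map (@comp_right_sign V A B C) n) =
  pos_map (@comp_right_sign V A B C) (g n).
Proof.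
by case: n => [[[l|l]|[]] ln]; rewrite /=; congr (pos_map _ (g _)); exact: sig_eq.
Qed.

Lemma comp_leafP V (A B C : formula V) (l : occ_leaves (comp_sequent A B C)) :
  (exists l', comp_left l' = l) \/ (exists l', comp_right l' = l).
Proof.
case: l => [[a|c]|[[b|b]|[]]].
- by left; exists (inl (inl a)).
- by right; exists (inl (inr c)).
- by left; exists (inl (inr b)).
- by right; exists (inl (inl b)).
Qed.

Lemma comp_left_inj V (A B C : formula V) : injective (@comp_left V A B C).
Proof. by case=> [[a|a]|[]] [[b|b]|[]] // [->]. Qed.

Lemma comp_right_inj V (A B C : formula V) : injective (@comp_right V A B C).
Proof. by case=> [[a|a]|[]] [[b|b]|[]] // [->]. Qed.

Lemma comp_left_right V (A B C : formula V) l l' :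
  @comp_left V A B C l = comp_right l' -> False.
Proof. by case: l l' => [[a|a]|[]] [[b|b]|[]]. Qed.

Lemma comp_negP V (A B C : formula V) (n : neg (occ_leaves (comp_sequent A B C))) :
  (exists m, n = neg_map (@comp_left_sign V A B C) m) \/
  (exists m, n = neg_map (@comp_right_sign V A B C) m).
Proof.
case: n => l ln; have [[l' e]|[l' e]] := comp_leafP l; subst l; [left|right].
  have ln' := ln; rewrite comp_left_sign in ln'.
  by exists (exist _ l' ln'); exact: sig_eq.
have ln' := ln; rewrite comp_right_sign in ln'.
by exists (exist _ l' ln'); exact: sig_eq.
Qed.

Lemma comp_posP V (A B C : formula V) (n : pos (occ_leaves (comp_sequent A B C))) :
  (exists m, n = pos_map (@comp_left_sign V A B C) m) \/
  (exists m, n = pos_map (@comp_right_sign V A B C) m).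
Proof.
case: n => l ln; have [[l' e]|[l' e]] := comp_leafP l; subst l; [left|right].
  have ln' := ln; rewrite comp_left_sign in ln'.
  by exists (exist _ l' ln'); exact: sig_eq.
have ln' := ln; rewrite comp_right_sign in ln'.
by exists (exist _ l' ln'); exact: sig_eq.
Qed.

Lemma comp_left_label V (A B C : formula V) (l : occ_leaves (hom_cut_sequent A B)) :
  occ_label (@comp_left V A B C l) = occ_label l.
Proof. by case: l => [[l|l]|[]]. Qed.

Lemma comp_right_label V (A B C : formula V) (l : occ_leaves (hom_cut_sequent B C)) :
  occ_label (@comp_right V A B C l) = occ_label l.
Proof. by case: l => [[l|l]|[]]. Qed.

Lemma union_matching V (A B C : formula V)
    (f : leaf_fun (hom_cut_sequent A B)) (g : leaf_fun (hom_cut_sequent B C)) :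
  matching f -> matching g -> matching (union_net f g).
Proof.
move=> /matchingP Hf /matchingP Hg; apply/matchingP => P.
have [fl fi fs] := Hf P; have [gl gi gs] := Hg P; split=> [n|n n'|p].
- have [[m ->]|[m ->]] := comp_negP n.
    by rewrite union_net_left /= !comp_left_label; exact: fl.
  by rewrite union_net_right /= !comp_right_label; exact: gl.
- have [[m ->]|[m ->]] := comp_negP n; have [[m' ->]|[m' ->]] := comp_negP n'.
  + rewrite !union_net_left /= !comp_left_label => mP m'P /(congr1 sval)/= e.
    apply: (congr1 (neg_map (@comp_left_sign V A B C))); apply: fi => //.
    exact/sig_eq/(comp_left_inj e).
  + by rewrite union_net_left union_net_right => _ _ /(congr1 sval)/comp_left_right.
  + by rewrite union_net_left union_net_right => _ _ /(congr1 sval)/esym/comp_left_right.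
  + rewrite !union_net_right /= !comp_right_label => mP m'P /(congr1 sval)/= e.
    apply: (congr1 (neg_map (@comp_right_sign V A B C))); apply: gi => //.
    exact/sig_eq/(comp_right_inj e).
- have [[q ->]|[q ->]] := comp_posP p; rewrite /= ?comp_left_label ?comp_right_label.
    move=> /fs[m mP <-]; exists (neg_map (@comp_left_sign V A B C) m).
      by rewrite /= comp_left_label.
    exact: union_net_left.
  move=> /gs[m mP <-]; exists (neg_map (@comp_right_sign V A B C) m).
    by rewrite /= comp_right_label.
  exact: union_net_right.
Qed.

Definition left_occ {V} {A B C : formula V} {T : formula V -> finType}
    (x : occ_sum T (hom_cut_sequent A B)) : occ_sum T (comp_sequent A B C) :=
  match x with
  | inl (inl a) => inl (inl a)
  | inl (inr b) => inr (inl (inl b))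
  | inr e => match e with end
  end.

Definition right_occ {V} {A B C : formula V} {T : formula V -> finType}
    (x : occ_sum T (hom_cut_sequent B C)) : occ_sum T (comp_sequent A B C) :=
  match x with
  | inl (inl b) => inr (inl (inr b))
  | inl (inr c) => inl (inr c)
  | inr e => match e with end
  end.

(** Two trees joined by one edge form a tree. *)
Lemma union_correct V (A B C : formula V)
    (f : leaf_fun (hom_cut_sequent A B)) (g : leaf_fun (hom_cut_sequent B C)) :
  correct f -> correct g -> correct (union_net f g).
Proof.
move=> cf cg s.
have [fsolv frig] := cf (s \o left_occ).
have [gsolv grig] := cg (s \o right_occ).
have lvl l : occ_map (@leaf_vertex V) (@comp_left V A B C l) =
    left_occ (occ_map (@leaf_vertex V) l) by case: l => [[l|l]|[]].
have lvr l : occ_map (@leaf_vertex V) (@comp_right V A B C l) =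
    right_occ (occ_map (@leaf_vertex V) l) by case: l => [[l|l]|[]].
split=> [we wc wl|phi [phie phic phil] u v].
  have [phi [phie _ phil]] := fsolv (we \o left_occ) xpred0 (wl \o @comp_left V A B C).
  have [psi [psie _ psil]] := gsolv (we \o right_occ) xpred0 (wl \o @comp_right V A B C).
  (* Flipping the whole side of [g] by [k] preserves its coboundary and gives the cut its prescribed
     weight. *)
  pose k := phi (inl (inr (root B))) (+) psi (inl (inl (root (dual B)))) (+) wc None.
  pose chi (v : occ_sum vertex (comp_sequent A B C)) : bool := match v with
    | inl (inl a) => phi (inl (inl a))
    | inl (inr c) => psi (inl (inr c)) (+) k
    | inr (inl (inl b)) => phi (inl (inr b))
    | inr (inl (inr b)) => psi (inl (inl b)) (+) k
    | inr (inr e) => match e with end end.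
  have chil v : chi (left_occ v) = phi v by case: v => [[v|v]|[]].
  have chir v : chi (right_occ v) = psi v (+) k by case: v => [[v|v]|[]].
  exists chi; split.
  - case=> [[a|c]|[[b|b]|[]]] ke.
    + exact: (phie (inl (inl a)) ke).
    + by rewrite /= addbACA addbb addbF; exact: (psie (inl (inr c)) ke).
    + exact: (phie (inl (inr b)) ke).
    + by rewrite /= addbACA addbb addbF; exact: (psie (inl (inl b)) ke).
  - case=> [[]|] /=; rewrite /k.
    by case: (phi _); case: (psi _); case: (wc _).
  - move=> n; have [[m ->]|[m ->]] := comp_negP n.
      by rewrite union_net_left /= !lvl !chil; exact: phil.
    by rewrite union_net_right /= !lvr !chir addbACA addbb addbF; exact: psil.
have phiL : coboundary f (s \o left_occ) xpred0 xpred0 xpred0 (phi \o left_occ).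
  split=> [[[e|e]|[]]|[]|n] => /=.
  - exact: (phie (inl (inl e))).
  - exact: (phie (inr (inl (inl e)))).
  - by have := phil (neg_map (@comp_left_sign V A B C) n);
      rewrite union_net_left /= !lvl.
have phiR : coboundary g (s \o right_occ) xpred0 xpred0 xpred0 (phi \o right_occ).
  split=> [[[e|e]|[]]|[]|n] => /=.
  - exact: (phie (inr (inl (inr e)))).
  - exact: (phie (inl (inr e))).
  - by have := phil (neg_map (@comp_right_sign V A B C) n);
      rewrite union_net_right /= !lvr.
have rootE v' : phi v' = phi (inr (inl (inl (root B)))).
  have /= := phic None => cutE.
  case: v' => [[a|c]|[[b|b]|[]]].
  - exact: (frig _ phiL (inl (inl a)) (inl (inr (root B)))).
  - have /= -> := grig _ phiR (inl (inr c)) (inl (inl (root (dual B)))).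
    by move: cutE; case: (phi _); case: (phi _).
  - exact: (frig _ phiL (inl (inr b)) (inl (inr (root B)))).
  - have /= -> := grig _ phiR (inl (inl b)) (inl (inl (root (dual B)))).
    by move: cutE; case: (phi _); case: (phi _).
by rewrite !rootE.
Qed.

Lemma id_matching V (A : formula V) : matching (id_net A).
Proof.
have labelD (B : formula V) (l : leaf B) : label (dual_leaf l) = dual_atom (label l).
  by elim: B l => [//|B IHB C IHC|B IHB C IHC] [l|l] /=; rewrite ?IHB ?IHC.
have labelU (B : formula V) (l : leaf (dual B)) : label (undual_leaf l) =
    dual_atom (label l).
  by rewrite -{2}(undual_leafK l) labelD dual_atomK.
have idK : involutive (@id_leaf V A).
  by case=> [[l|l]|[]] /=; rewrite ?undual_leafK ?dual_leafK.
have label_id l : occ_label (@id_leaf V A l) = dual_atom (occ_label l).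
  by case: l => [[l|l]|[]]; [exact: labelU | exact: labelD].
apply/matchingP => P; split=> [n nP|n n' nP n'P e|p pP].
- by rewrite /= label_id nP.
- by apply: sig_eq; apply: (can_inj idK); exact: (congr1 sval e).
- have pn : ~~ @positive (occ_leaves (hom_cut_sequent A A)) (id_leaf (sval p)).
    by rewrite id_leaf_sign negbK (svalP p).
  exists (exist _ (id_leaf (sval p)) pn); first by rewrite /= label_id pP.
  by apply: sig_eq; rewrite /= idK.
Qed.

(** * Identity proof nets *)

Definition formula_coboundary {V} (A : formula V) (s : vertex A -> bool)
    (w : edge A -> bool) (phi : vertex A -> bool) : Prop :=
  forall e, is_par (parent e) ==> (side e == s (parent e)) ->
    phi (parent e) (+) phi (child e) = w e.

(** This is the colouring criterion for two switched parse trees joined by one edge per leaf. The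
    bijection [d] is left general so that a formula and its dual can exchange roles. *)
Definition linked_tree {V} (A A' : formula V) (d : leaf A -> leaf A') : Prop :=
  forall (s : vertex A -> bool) (s' : vertex A' -> bool),
  (forall w w' wl, exists phi phi', [/\ formula_coboundary s w phi,
     formula_coboundary s' w' phi' &
     forall l, phi (leaf_vertex l) (+) phi' (leaf_vertex (d l)) = wl l]) /\
  (forall phi phi', formula_coboundary s xpred0 phi ->
     formula_coboundary s' xpred0 phi' ->
     (forall l, phi (leaf_vertex l) (+) phi' (leaf_vertex (d l)) = false) ->
     forall v v', phi v = phi' v').

Lemma linked_tree_sym V (A A' : formula V) (d : leaf A -> leaf A') u :
  cancel d u -> cancel u d -> linked_tree d -> linked_tree u.
Proof.
move=> dK uK tree s s'; have [solv rig] := tree s' s; split.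
  move=> w w' wl; have [phi [phi' [cp cp' lp]]] := solv w' w (wl \o d).
  by exists phi', phi; split=> // l; have := lp (u l); rewrite /= !uK addbC.
move=> phi phi' cp cp' lp v v'; symmetry; apply: rig => // l.
by have := lp (d l); rewrite dK addbC.
Qed.

(** The tensor root joins the trees for [B] and [C] into one, and the par root hangs from it by its
    single kept edge. *)
Lemma linked_tree_tensor V (B B' C C' : formula V)
    (dB : leaf B -> leaf B') (dC : leaf C -> leaf C')
    (d : leaf (Tensor B C) -> leaf (Par B' C')) :
  (forall b, d (inl b) = inl (dB b)) -> (forall c, d (inr c) = inr (dC c)) ->
  linked_tree dB -> linked_tree dC -> linked_tree d.
Proof.
move=> dl dr treeB treeC s s'.
have [solvB rigB] := treeB (fun v => s (Some (inl v))) (fun v => s' (Some (inl v))).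
have [solvC rigC] := treeC (fun v => s (Some (inr v))) (fun v => s' (Some (inr v))).
split=> [w w' wl|phi phi' cp cp' lp].
  have [pB [pB' [cB cB' lB]]] := solvB (fun e => w (inr (inl e)))
    (fun e => w' (inr (inl e))) (fun l => wl (inl l)).
  have [pC [pC' [cC cC' lC]]] := solvC (fun e => w (inr (inr e)))
    (fun e => w' (inr (inr e))) (fun l => wl (inr l)).
  (* [t] is the colour of the tensor root, dictated by [B]; [k] flips the whole [C] part to match
     it; [p] is the colour of the par root, dictated by the premise that the switching keeps. *)
  pose t := pB (root B) (+) w (inl false).
  pose k := pC (root C) (+) t (+) w (inl true).
  pose p := (if s' None then pC' (root C') (+) k else pB' (root B')) (+)
    w' (inl (s' None)).
  exists (fun v : vertex (Tensor B C) => match v with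
    | None => t | Some (inl v) => pB v | Some (inr v) => pC v (+) k end).
  exists (fun v : vertex (Par B' C') => match v with
    | None => p | Some (inl v) => pB' v | Some (inr v) => pC' v (+) k end).
  split=> [[[]|[e|e]] ke|[i|[e|e]] ke|[l|l]] /=.
  - by rewrite /k; case: (pC _); case: (t); case: (w _).
  - by rewrite /t; case: (pB _); case: (w _).
  - exact: cB.
  - by rewrite addbACA addbb addbF; exact: cC.
  - move: ke => /= /eqP ->; rewrite /p; case: (s' None); case: (w' _).
    + by case: (pC' _); case: (k).
    + by case: (pC' _); case: (k).
    + by case: (pB' _).
    + by case: (pB' _).
  - exact: cB'.
  - by rewrite addbACA addbb addbF; exact: cC'.
  - by rewrite dl; exact: lB.
  - by rewrite dr addbACA addbb addbF; exact: lC.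
have eB : forall v v', phi (Some (inl v)) = phi' (Some (inl v')).
  apply: (rigB (fun v => phi (Some (inl v))) (fun v => phi' (Some (inl v)))).
  - by move=> e; exact: (cp (inr (inl e))).
  - by move=> e; exact: (cp' (inr (inl e))).
  - by move=> l; have := lp (inl l); rewrite dl.
have eC : forall v v', phi (Some (inr v)) = phi' (Some (inr v')).
  apply: (rigC (fun v => phi (Some (inr v))) (fun v => phi' (Some (inr v)))).
  - by move=> e; exact: (cp (inr (inr e))).
  - by move=> e; exact: (cp' (inr (inr e))).
  - by move=> l; have := lp (inr l); rewrite dr.
have tB : phi None = phi (Some (inl (root B))).
  by have /= := cp (inl false) isT; case: (phi _); case: (phi _).
have tC : phi None = phi (Some (inr (root C))).
  by have /= := cp (inl true) isT; case: (phi _); case: (phi _).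
have pE : phi' None = phi None.
  have /= := cp' (inl (s' None)); rewrite eqxx => /(_ isT).
  case: (s' None); rewrite -?(eB (root B)) -?(eC (root C)) -?tB -?tC;
  by case: (phi _); case: (phi' _).
have vE v : phi v = phi None.
  case: v => [[v|v]|] //; first by rewrite tB (eB v (root B')) (eB _ (root B')).
  by rewrite tC (eC v (root C')) (eC _ (root C')).
move=> v [[v'|v']|].
- by rewrite vE tB; exact: eB.
- by rewrite vE tC; exact: eC.
- by rewrite vE pE.
Qed.

(** The dual of a par is a tensor, so the par case is the tensor case read from the dual side. *)
Lemma linked_tree_dual V (A : formula V) : linked_tree (@dual_leaf V A).
Proof.
elim: A => [a|B IHB C IHC|B IHB C IHC].
- move=> s s'; split=> [w w' wl|phi phi' _ _ /(_ tt) lp [] []].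
    by exists wl, xpred0; split=> [[]|[]|l] //=; rewrite addbF.
  by move: lp => /=; case: (phi _); case: (phi' _).
- exact: linked_tree_tensor IHB IHC.
- apply: (@linked_tree_sym V _ (Par B C) (@undual_leaf V (Par B C))).
  + exact: (@undual_leafK V (Par B C)).
  + exact: (@dual_leafK V (Par B C)).
  apply: (@linked_tree_tensor V (dual B) B (dual C) C
    (@undual_leaf V B) (@undual_leaf V C)) => //.
    exact: linked_tree_sym (@dual_leafK V B) (@undual_leafK V B) IHB.
  exact: linked_tree_sym (@dual_leafK V C) (@undual_leafK V C) IHC.
Qed.

Lemma id_correct V (A : formula V) : correct (id_net A).
Proof.
move=> s; have [solv rig] := linked_tree_dual (s \o inl \o inr) (s \o inl \o inl).
split=> [we wc wl|phi [phie _ phil]].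
  (* The weight of a link is indexed by its negative end: the leaf of the dual if [l] is positive,
     and [l] itself otherwise. *)
  have [phi [phi' [cp cp' lp]]] := solv (we \o inl \o inr) (we \o inl \o inl)
    (fun l : leaf A => if positive (l : leaves A) then wl (inl (inl (dual_leaf l)))
       else wl (inl (inr l))).
  exists (fun v : occ_sum vertex (hom_cut_sequent A A) => match v with
    | inl (inl v) => phi' v | inl (inr v) => phi v | inr v => match v with end end).
  split=> [[[e|e]|[]] ke|[]|[[[l|l]|[]] ln]] /=.
  - exact: cp'.
  - exact: cp.
  - have := lp (undual_leaf l); rewrite undual_leafK addbC => ->.
    by rewrite positive_undual ln.
  - by rewrite lp /= ifN.
have vE : forall v v', phi (inl (inr v)) = phi (inl (inl v')).
  apply: (rig (phi \o inl \o inr) (phi \o inl \o inl)) => [e ke|e ke|l] /=.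
  - exact: (phie (inl (inr e)) ke).
  - exact: (phie (inl (inl e)) ke).
  case pl: (positive (l : leaves A)); last first.
    have ln : ~~ @positive (occ_leaves (hom_cut_sequent A A)) (inl (inr l)).
      exact: negbT pl.
    pose n : neg (occ_leaves (hom_cut_sequent A A)) :=
      exist (fun l => ~~ @positive (occ_leaves (hom_cut_sequent A A)) l) _ ln.
    exact: (phil n).
  have ln : ~~ @positive (occ_leaves (hom_cut_sequent A A)) (inl (inl (dual_leaf l))).
    by rewrite [positive _](positive_dual l) pl.
  pose n : neg (occ_leaves (hom_cut_sequent A A)) :=
      exist (fun l => ~~ @positive (occ_leaves (hom_cut_sequent A A)) l) _ ln.
  by have := phil n; rewrite /= dual_leafK addbC.
by case=> [[u|u]|[]] [[v|v]|[]]; rewrite -?(vE (root A)) ?(vE _ (root (dual A))).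
Qed.

(** * Paths across the cuts *)

Fixpoint cut_mate {V} (D : seq (formula V)) : cuts_sum leaf D -> cuts_sum leaf D :=
  match D with
  | [::] => fun c => c
  | A :: D => fun c => match c with
      | inl (inl l) => inl (inr (dual_leaf l))
      | inl (inr l) => inl (inl (undual_leaf l))
      | inr c => inr (cut_mate c) end
  end.

(* The leaf function is followed from the target of a negative leaf, crossing
   the cuts, until a leaf of the conclusion is reached; this computes the normal
   form without eliminating the cuts. *)
Inductive run {V} {G : sequent V} {D} (f : leaf_fun (CutSequent G D)) :
    occ_sum leaf (CutSequent G D) -> sequent_sum leaf G -> Prop :=
| run_stop l : run f (inl l) l
| run_go c n q : sval n = inr (cut_mate c) -> run f (sval (f n)) q ->
    run f (inr c) q.

Lemma run_stopE V (G : sequent V) D (f : leaf_fun (CutSequent G D)) l q :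
  run f (inl l) q -> l = q.
Proof. by move=> r; inversion r. Qed.

Lemma run_goE V (G : sequent V) D (f : leaf_fun (CutSequent G D)) c q :
  run f (inr c) q -> exists2 n, sval n = inr (cut_mate c) & run f (sval (f n)) q.
Proof. by move=> r; inversion r; subst; exists n. Qed.

Lemma run_fun V (G : sequent V) D (f : leaf_fun (CutSequent G D)) l q q' :
  run f l q -> run f l q' -> q = q'.
Proof.
move=> r; elim: r q' => {l q} [l q' /run_stopE //|c n q nE _ IH q'].
by move=> /run_goE[n' n'E]; rewrite -nE in n'E; rewrite (sig_eq n'E) => /IH.
Qed.

Lemma cut_mate_residual V D D' (s : @cut_step V D D') c :
  cuts_residual s (cut_mate c) = cut_mate (cuts_residual s c).
Proof.
elim: s c => {D D'} [a D|B C D|B C D|A D D' s IH] //=.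
- by case=> [[]|[[]|]].
- by case=> [[]|[[]|]].
- by case=> [[]|c] //=; rewrite IH.
Qed.

(** A step deletes at most one cut pair, so two deleted leaves of opposite sign are its two ends. *)
Lemma cut_mate_deleted V D D' (s : @cut_step V D D') c c' :
  cuts_deleted s c -> cuts_deleted s c' ->
  positive_atom (cuts_case (@label V) c) ->
  ~~ positive_atom (cuts_case (@label V) c') -> c' = cut_mate c.
Proof.
elim: s c c' => {D D'} [a D|B C D|B C D|A D D' s IH] //=.
- by case=> [[[]|[]]|//] [[[]|[]]|//] //= _ _ ->.
- by case=> [//|c] [//|c'] /= d d' p n; rewrite (IH c c').
Qed.

(** A reset edge short-cuts a run: before the step, the run reaches the deleted positive leaf,
    crosses to its mate [m] and goes on from [f m]. *)
Lemma run_target_step V (G : sequent V) D D' (s : cut_step D D')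
    (f : leaf_fun (CutSequent G D)) (f' : leaf_fun (CutSequent G D')) n q :
  eliminates s f f' ->
  run f (residual s (sval (f' n))) q ->
  run f (sval (f (neg_map (@residual_sign V G D D' s) n))) q.
Proof.
move=> /(_ n); set p := f (neg_map _ n) => /=.
case: ifP => [dp [m dm] e r|_ <- //].
have fm : run f (sval (f m)) q by rewrite -e.
case: p dp => [[//|c] pc] /= dc.
apply: run_go fm; case: m {e} dm => [[//|c'] nc'] /= dc'.
by rewrite (cut_mate_deleted dc dc' pc nc').
Qed.

(** Going from the reduct back to the original net, the induction is on a run already known to be
    finite. *)
Lemma run_step V (G : sequent V) D D' (s : cut_step D D')
    (f : leaf_fun (CutSequent G D)) (f' : leaf_fun (CutSequent G D')) l q :
  eliminates s f f' -> run f' l q -> run f (residual s l) q.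
Proof.
move=> ff'; elim=> {l q} [l|c n q nE _ IH]; first exact: run_stop.
apply: (@run_go _ _ _ _ _ (neg_map (@residual_sign V G D D' s) n)).
  by rewrite /= nE /= cut_mate_residual.
exact: run_target_step IH.
Qed.

(** With no cut left, the run from any target stops immediately; pulling it back step by step gives
    a run of the original net. *)
Lemma normal_form_run V (G : sequent V) (x : net G) h :
  is_normal_form x h ->
  forall (n : neg (occ_leaves (CutSequent G [::])))
    (m : neg (occ_leaves (CutSequent G (projT1 x)))) l q,
  sval n = inl l -> sval m = inl l -> sval (h n) = inl q ->
  run (projT2 x) (sval (projT2 x m)) q.
Proof.
pose R (y : net G) l q := forall m : neg (occ_leaves (CutSequent G (projT1 y))),
  sval m = inl l -> run (projT2 y) (sval (projT2 y m)) q.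
have RP y z l q : clos_refl_trans (net G) elim_step y z -> R z l q -> R y l q.
  move=> yz; elim: yz l q => {y z} [[D f] [D' f'] [/= s ff'] l q Rz|//|].
    2: by move=> y1 y z _ IH1 _ IH2 l q /IH2/IH1.
  move=> [m mn] /= mE; subst m.
  pose n : neg (occ_leaves (CutSequent G D')) :=
    exist (fun l => ~~ @positive (occ_leaves (CutSequent G D')) l) (inl l) mn.
  have -> : exist _ (inl l) mn = neg_map (@residual_sign V G D D' s) n.
    exact: sig_eq.
  apply: (run_target_step ff'); apply: (run_step ff').
  exact: (Rz n).
move=> /RP xR n m l q nE mE hE; apply: xR (m) mE => n' n'E /=.
have -> : n' = n by apply: sig_eq; rewrite n'E nE.
by rewrite hE; exact: run_stop.
Qed.

(** Both normal forms send a leaf to the exit of one and the same run of [x], and runs are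
    deterministic. *)
Lemma normal_form_unique V (G : sequent V) (x : net G) h h' :
  is_normal_form x h -> is_normal_form x h' -> h = h'.
Proof.
move=> nh nh'; apply: funext => n; apply: sig_eq.
case: n => [[l|[]] ln].
pose n : neg (occ_leaves (CutSequent G [::])) :=
  exist (fun l => ~~ @positive (occ_leaves (CutSequent G [::])) l) (inl l) ln.
pose m : neg (occ_leaves (CutSequent G (projT1 x))) :=
  exist (fun l => ~~ @positive (occ_leaves (CutSequent G (projT1 x))) l) (inl l) ln.
rewrite -[exist _ _ _]/n.
case e: (sval (h n)) => [q|//]; case e': (sval (h' n)) => [q'|//].
have r : run (projT2 x) (sval (projT2 x m)) q by exact: normal_form_run e.
have r' : run (projT2 x) (sval (projT2 x m)) q' by exact: normal_form_run e'.
by rewrite (run_fun r r').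
Qed.

(** * Agreement of runs with path composition in GoI(Setp) *)

Definition underlying_fun {V} {A B : formula V} (f : leaf_fun (hom_cut_sequent A B)) :
    goi_hom (leaves A) (leaves B) :=
  fun x => Some (hom_target (f (hom_source x))).

Lemma hom_target_inj V (A B : formula V) : injective (@hom_target V A B).
Proof.
move=> [[[a|b]|[]] p] [[[a'|b']|[]] p'] //= [e]; apply: sig_eq => /=.
  by rewrite -(undual_leafK a) e undual_leafK.
by rewrite e.
Qed.

Lemma hom_source_surj V (A B : formula V) (n : neg (occ_leaves (hom_cut_sequent A B))) :
  exists x, hom_source x = n.
Proof.
case: n => [[[a|b]|[]] ln].
  have p : positive (undual_leaf a : leaves A) by rewrite positive_undual.
  exists (inl (exist (fun l => @positive (leaves A) l) (undual_leaf a) p)).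
  by apply: sig_eq; rewrite /= undual_leafK.
by exists (inr (exist (fun l => ~~ @positive (leaves B) l) b ln)); apply: sig_eq.
Qed.

Lemma underlying_fun_inj V (A B : formula V) : injective (@underlying_fun V A B).
Proof.
move=> f g e; apply: funext => n; have [x <-] := hom_source_surj n.
by apply: hom_target_inj; have := congr1 (@^~ x) e => -[].
Qed.

Lemma underlying_id V (A : formula V) : underlying_fun (id_net A) = goi_id (leaves A).
Proof.
apply: funext => [[p|n]] /=; congr Some.
  by congr inr; apply: sig_eq; rewrite /= dual_leafK.
by congr inl; apply: sig_eq; rewrite /= dual_leafK.
Qed.

(** Crossing the cut on [B] is handing the value over between [f] and [g]: a positive leaf of the
    dual of [B] reached by [g] is a negative leaf of [B], where [f] resumes. The two claims
    alternate, so they are proved together. *)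
Lemma run_goi_result V (A B C : formula V)
    (f : leaf_fun (hom_cut_sequent A B)) (g : leaf_fun (hom_cut_sequent B C))
    (F := underlying_fun f) (G := underlying_fun g) l q :
  run (union_net f g) l q ->
  forall t : pos (occ_leaves (hom_cut_sequent A C)), sval t = inl q ->
  (forall p, comp_left (sval p) = l ->
     goi_result F G (after_left (hom_target p)) (hom_target t)) /\
  (forall p, comp_right (sval p) = l ->
     goi_result F G (after_right (hom_target p)) (hom_target t)).
Proof.
elim=> {l q} [l|c n q nE _ IH] [t tp] /= te; subst t; split.
- case=> [[[a|b]|[]] lp] //= [e]; subst l.
  have -> : tp = lp by exact: bool_irrelevance.
  exact: goi_stop.
- case=> [[[a|b]|[]] lp] //= [e]; subst l.
  have -> : tp = lp by exact: bool_irrelevance.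
  exact: goi_stop.
- case=> [[[a|b]|[]] lp] //= [e]; subst c.
  pose b' : pos (leaves B) := exist _ b lp.
  apply: (@goi_go _ _ _ _ _ (inl b')) => //=.
  have [_] := IH (exist _ (inl q) tp) erefl; apply.
  have -> : n = neg_map (@comp_right_sign V A B C) (hom_source (inl b')).
    exact: sig_eq.
  by rewrite union_net_right.
- case=> [[[b|a]|[]] lp] //= [e]; subst c.
  set b' := (X in goi_result _ _ (inr (inr X))).
  apply: (@goi_go _ _ _ F G (inr b')) => //=.
  have [+ _] := IH (exist _ (inl q) tp) erefl; apply.
  have -> : n = neg_map (@comp_left_sign V A B C) (hom_source (inr b')).
    exact: sig_eq.
  by rewrite union_net_left.
Qed.

(** For each start, the target in the normal form is the exit of a run, which is a terminating GoI
    path; hence the composite is defined there with that value. *)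
Lemma underlying_comp V (A B C : formula V)
    (f : leaf_fun (hom_cut_sequent A B)) (g : leaf_fun (hom_cut_sequent B C)) h :
  is_normal_form
    (existT (fun D => leaf_fun (CutSequent (hom_sequent A C) D)) [:: B]
       (union_net f g)) h ->
  underlying_fun h = goi_comp (underlying_fun f) (underlying_fun g).
Proof.
move=> nf; apply: funext => x; symmetry; apply/goi_compP.
case e: (sval (h (hom_source x))) => [q|[]].
case: x e => [a|c] e.
  pose m := neg_map (@comp_left_sign V A B C) (hom_source (inl a)).
  have r : run (union_net f g) (sval (union_net f g m)) q
  := normal_form_run nf (n := hom_source (inl a)) (m := m) erefl erefl e.
  rewrite union_net_left in r; have [+ _] := run_goi_result r e.
  by move=> /(_ _ erefl) res; exists (after_left (hom_target (f (hom_source (inl a))))).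
pose m := neg_map (@comp_right_sign V A B C) (hom_source (inr c)).
have r : run (union_net f g) (sval (union_net f g m)) q
  := normal_form_run nf (n := hom_source (inr c)) (m := m) erefl erefl e.
rewrite union_net_right in r; have [_] := run_goi_result r e.
by move=> /(_ _ erefl) res; exists (after_right (hom_target (g (hom_source (inr c))))).
Qed.

Theorem mainTheorem6 (V : Type) :
  exists N : category (@net_hom V),
    is_proof_net_category N /\
    is_functor N GoI_Setp (@leaves V) (@underlying V) /\
    is_faithful N GoI_Setp (@leaves V) (@underlying V).
Proof.
have faithful A B : injective (@underlying V A B).
  move=> [f pf] [g pg] /underlying_fun_inj /= e; subst g.
  by rewrite (Prop_irrelevance pf pg).
have id_proof A : is_proof_net (id_net A : leaf_fun (@hom_cut_sequent V A A)).
  by apply/is_proof_netP; split; [exact: id_matching | exact: id_correct].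
pose idn A : net_hom A A := exist _ (id_net A) (id_proof A).
have comp_exists A B C (f : @net_hom V A B) (g : net_hom B C) :
    exists h : net_hom A C, is_normal_form
      (existT (fun D => leaf_fun (CutSequent (hom_sequent A C) D)) [:: B]
         (union_net (sval f) (sval g))) (sval h).
  have [mf cf] := (is_proof_netP _).1 (svalP f).
  have [mg cg] := (is_proof_netP _).1 (svalP g).
  have [|h /is_proof_netP ph nf] := @normal_form_exists V _
    (existT (fun D => leaf_fun (CutSequent (hom_sequent A C) D)) [:: B]
       (union_net (sval f) (sval g))).
    by split; [exact: union_matching | exact: union_correct].
  by exists (exist _ h ph).
pose compn A B C (f : net_hom A B) (g : net_hom B C) : net_hom A C :=
  sval (cid (comp_exists A B C f g)).
have compP A B C (f : net_hom A B) (g : net_hom B C) :=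
  svalP (cid (comp_exists A B C f g)).
have Fcomp A B C (f : net_hom A B) (g : net_hom B C) :
    underlying (compn A B C f g) = goi_comp (underlying f) (underlying g).
  exact: underlying_comp (compP A B C f g).
have Fid A : underlying (idn A) = goi_id (leaves A) by exact: underlying_id.
have idl A B f : compn A A B (idn A) f = f.
  by apply: faithful; rewrite Fcomp Fid goi_idl.
have idr A B f : compn A B B f (idn B) = f.
  by apply: faithful; rewrite Fcomp Fid goi_idr.
have assoc A B C D f g h :
    compn A B D f (compn B C D g h) = compn A C D (compn A B C f g) h.
  by apply: faithful; rewrite !Fcomp goi_compA.
exists (Category idl idr assoc); split; [split=> //|by split].
move=> A B C f g h; split=> [nf|->]; last exact: compP.
exact: normal_form_unique nf (compP A B C f g).
Qed.
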